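(* Let $\lambda_2$ be a positive integer, $\delta$ a non-negative integer, and $\lambda_1=\lambda_2+\delta$. The average case complexity of the Novelli--Pak--Stoyanovskii algorithm on the partition $\lambda=(\lambda_1,\lambda_2)$ satisfies $$\begin{aligned} C(\lambda_1,\lambda_2)={}&\frac{\lambda_1(\lambda_1-1)}{4}+\frac{\lambda_2(\lambda_2-3)}{4}\\ &-2\Bigg(\Big(-1-\delta+\frac{(\delta+1)2^{2\lambda_2}}{\binom{2\lambda_2}{\lambda_2}}\Big)\sum_{i=1}^{\delta}\frac{2^i\binom{i+\lambda_2}{i}}{\binom{i+2\lambda_2}{i}(1+i+2\lambda_2)}\\ &\quad+\frac{2^{\delta+2}\lambda_2(1+\delta+\lambda_2)\binom{\delta+\lambda_2}{\delta}}{\binom{\delta+2\lambda_2}{\delta}(1+\delta+2\lambda_2)}\sum_{i=1}^{\delta}\frac{2^{-i}\binom{i+2\lambda_2}{i}}{\binom{i+\lambda_2}{i}(i+2\lambda_2)}\\ &\quad-2(\delta+1)\lambda_2\sum_{i=1}^{\delta}\frac{2^i\binom{i+\lambda_2}{i}}{\binom{i+2\lambda_2}{i}(1+i+2\lambda_2)}\sum_{j=1}^{i}\frac{2^{-j}\binom{j+2\lambda_2}{j}}{\binom{j+\lambda_2}{j}(j+2\lambda_2)}\\ &\quad+\frac{2^{2\lambda_2}(\delta+1)}{\binom{2\lambda_2}{\lambda_2}(2\lambda_2+1)}+\frac{2^{\delta+1}(1+\delta+\lambda_2)\binom{\delta+\lambda_2}{\delta}}{\binom{\delta+2\lambda_2}{\delta}\binom{2\lambda_2}{\lambda_2}(1+\delta+2\lambda_2)}\Big(-2^{2\lambda_2}+\binom{2\lambda_2}{\lambda_2}\Big)\\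 &\quad-\frac{\delta+1}{2\lambda_2+1}+(\delta+1)H_{\delta+2\lambda_2}+\tfrac12(\delta+1)H_{\lambda_2}-(\delta+1)H_{2\lambda_2}-(\delta+1)H_\delta\Bigg). \end{aligned}$$
   Context: $H_m=\sum_{\ell=1}^m\frac1\ell$ denotes the $m$-th harmonic number ($H_0=0$). A partition $\lambda$ of $n$ is identified with its Young diagram $\{(i,j):1\le i\le l(\lambda),\ 1\le j\le\lambda_i\}$ ($l(\lambda)$ is the number of parts), whose elements are called cells. A cell $(i,j)$ is a corner of $\lambda$ if neither $(i+1,j)$ nor $(i,j+1)$ belongs to $\lambda$. A tableau of shape $\lambda$ is a bijection $T:\lambda\to\{1,\dots,n\}$; the set of tableaux is $\mathrm{T}(\lambda)$. The (column-wise) Novelli--Pak--Stoyanovskii (NPS) algorithm applied to $T\in \mathrm{T}(\lambda)$: order cells by $(i,j)\preceq(i',j')$ if $j<j'$, or $j=j'$ and $i\le i'$. Let $(i_1,j_1)\succ\dots\succ(i_n,j_n)$ be the cells of $\lambda$ in decreasing order, put $k_r=T(i_r,j_r)$ (entries of the initial tableau) and $T_0=T$. For $r=1,\dots,n$ the tableau $T_r$ is obtained from $T_{r-1}$ as follows. Start with the current tableau equal to $T_{r-1}$ and repeat: let $(i,j)$ be the cell of the current tableau containing $k_r$. If $(i,j)$ is a corner of $\lambda$, stop. Otherwise let $m$ be the minimum of the entries of the current tableau in the cells of $\lambda\cap\{(i+1,j),(i,j+1)\}$. If $k_r<m$, stop. If $m<k_r$, exchange the entries $m$ and $k_r$ (one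 exchange) and repeat. When stopped, $T_r$ is the current tableau. $n(T)$ is the total number of exchanges performed during the construction of $T_1,\dots,T_n$, and $C(\lambda)=\frac1{n!}\sum_{T\in \mathrm{T}(\lambda)}n(T)$; $C(\lambda_1,\lambda_2)$ means $C(\lambda)$ for $\lambda=(\lambda_1,\lambda_2)$. *)

(* Defs.v *)
From mathcomp Require Import all_boot all_order all_algebra.

Set Implicit Arguments.
Unset Strict Implicit.
Unset Printing Implicit Defensive.

Import GRing.Theory.

(* A partition is the weakly decreasing sequence of its (positive) parts; rows
   and columns are numbered from 1. *)
Definition cells (la : seq nat) : seq (nat * nat) :=
  [seq (i, j) | i <- iota 1 (size la), j <- iota 1 (nth 0 la i.-1)].

Definition cell (la : seq nat) : finType := seq_sub (cells la).

(* The value v : 'I_n stands for the entry v + 1 of {1, ..., n}; the shift is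
   made in [entry] below. *)
Definition tableaux (la : seq nat) : {set {ffun cell la -> 'I_(sumn la)}} :=
  [set T : {ffun cell la -> 'I_(sumn la)} |
    injectiveb T && [forall k, exists c, T c == k]].

(* The algorithm runs on total functions, of which only the values on
   [cells la] matter; [entry T] takes the junk value 0 elsewhere. *)
Definition filling := nat * nat -> nat.

Definition entry (la : seq nat) (T : {ffun cell la -> 'I_(sumn la)}) : filling :=
  fun c => if insub c is Some x then (T x).+1 else 0.

Definition below (c : nat * nat) := (c.1.+1, c.2).
Definition right_of (c : nat * nat) := (c.1, c.2.+1).

Definition corner (la : seq nat) (c : nat * nat) : bool :=
  (below c \notin cells la) && (right_of c \notin cells la).

Definition cell_of (la : seq nat) (U : filling) (k : nat) : nat * nat :=
  nth (0, 0) (cells la) (find (fun c => U c == k) (cells la)).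

Definition min_neighbour (la : seq nat) (U : filling) (c : nat * nat) : nat :=
  let s := [seq U d | d <- [:: below c; right_of c] & d \in cells la] in
  foldr minn (head 0 s) s.

Definition exchange (U : filling) (k m : nat) : filling :=
  fun c => if U c == k then m else if U c == m then k else U c.

(* Is one more exchange of the entry k to be performed in U? *)
Definition moves (la : seq nat) (k : nat) (U : filling) : bool :=
  ~~ corner la (cell_of la U k) && (min_neighbour la U (cell_of la U k) < k).

(* The loop that moves the entry k, with its number of exchanges; at most
   [fuel] exchanges are made. *)
Fixpoint slide (la : seq nat) (k fuel : nat) (U : filling) : filling * nat :=
  if fuel is f.+1 then
    if moves la k U then
      let: (U', e) :=
        slide la k f (exchange U k (min_neighbour la U (cell_of la U k))) in
      (U', e.+1)
    else (U, 0)
  else (U, 0).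

Definition col_le (c d : nat * nat) : bool :=
  (c.2 < d.2) || ((c.2 == d.2) && (c.1 <= d.1)).

(* Each exchange increases i + j by 1 for the cell (i, j) of the moved entry,
   and 2 <= i + j <= size la + head 0 la in the diagram of a partition, so the
   fuel below never runs out (see [slide_stops]). *)
Definition slide_fuel (la : seq nat) : nat := size la + head 0 la.

Definition nps_step (la : seq nat) (T : filling)
    (st : filling * nat) (c : nat * nat) : filling * nat :=
  let: (U, e) := slide la (T c) (slide_fuel la) st.1 in (U, st.2 + e).

Definition nps (la : seq nat) (T : filling) : filling * nat :=
  foldl (nps_step la T) (T, 0) (sort (fun c d => col_le d c) (cells la)).

Definition nps_exchanges (la : seq nat) (T : filling) : nat := (nps la T).2.

Local Open Scope ring_scope.

Definition nps_complexity (la : seq nat) : rat :=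
  (\sum_(T in tableaux la) (nps_exchanges la (entry T))%:R) / (sumn la)`!%:R.

Definition harmonic (m : nat) : rat := \sum_(1 <= l < m.+1) l%:R^-1.

Local Close Scope ring_scope.

Lemma mem_cells la c :
  (c \in cells la) = [&& 0 < c.1, 0 < c.2 & c.2 <= nth 0 la c.1.-1].
Proof.
case: c => i j; apply/allpairsPdep/idP => /= [[i' [j' []]]|/and3P[i0 j0 jl]].
  rewrite !mem_iota !add1n !ltnS => /andP[i0 _] /andP[j0 jl] [-> ->].
  by rewrite i0 j0 jl.
exists i, j; rewrite !mem_iota !add1n !ltnS i0 j0 jl; split=> //.
rewrite leqNgt; apply/negP => lti; move: jl.
by rewrite nth_default ?leqn0; [case: j j0 | case: i i0 lti].
Qed.

Lemma cell_ofP la (U : filling) k c : {in cells la &, injective U} ->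
  c \in cells la -> U c = k -> cell_of la U k = c.
Proof.
move=> injU cl Uc; have hk : has (fun d => U d == k) (cells la).
  by apply/hasP; exists c; rewrite ?Uc.
apply: injU => //; last by rewrite Uc; apply/eqP; exact: (nth_find (0, 0) hk).
by rewrite /cell_of mem_nth // -has_find.
Qed.

Lemma slide_stops la k f (U : filling) c : sorted geq la ->
  {in cells la &, injective U} -> c \in cells la -> U c = k ->
  slide_fuel la <= c.1 + c.2 + f -> ~~ moves la k (slide la k f U).1.
Proof.
move=> sla; elim: f U c => [|f IHf] U c injU cl Uc lef.
  rewrite /= /moves (cell_ofP injU cl Uc) negb_and negbK; apply/orP; left.
  have lenth i : nth 0 la i <= head 0 la.
    have [li|li] := leqP (size la) i; first by rewrite nth_default.
    rewrite -nth0.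
    have gt : transitive geq by move=> y x z /= yx zy; apply: leq_trans zy yx.
    apply: (sorted_leq_nth gt (fun n => leqnn n)) => //; rewrite inE //.
    by apply: leq_ltn_trans li.
  have out d : c.1 + c.2 < d.1 + d.2 -> d \notin cells la.
    move=> lt; apply/negP; rewrite mem_cells => /and3P[d1 d2 d3].
    have ds : d.1 <= size la.
      rewrite leqNgt; apply/negP => lti; move: d3.
      rewrite nth_default ?leqn0; first by case: (d.2) d2.
      by case: (d.1) d1 lti.
    have := leq_trans lt (leq_add ds (leq_trans d3 (lenth _))).
    by rewrite ltnNge -/(slide_fuel la) -[c.1 + c.2]addn0 lef.
  by rewrite /corner !out //= ?addnS ?addSn ltnSn.
rewrite /=; case: ifP => [|/negbT//].
case E: slide => [U' e] /= mv.
move: mv E; rewrite /moves (cell_ofP injU cl Uc) => /andP[ncor mk].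
set m := min_neighbour la U c in mk *.
have [d [dl Ud dc]] : exists d, [/\ d \in cells la, U d = m
    & d.1 + d.2 = (c.1 + c.2).+1].
  move: ncor; rewrite /m /min_neighbour /corner negb_and !negbK /=.
  case bl: (below c \in cells la); case rl: (right_of c \in cells la) => //= _.
  - have [le|lt] := leqP (U (below c)) (U (right_of c)).
      exists (below c); split=> //.
      by rewrite minnn.
    exists (right_of c); split=> //; last by rewrite /= addnS.
    by rewrite (minn_idPr (ltnW lt)).
  - by exists (below c); rewrite minnn.
  - by exists (right_of c); rewrite minnn /= addnS.
move=> E; have -> : U' = (slide la k f (exchange U k m)).1 by rewrite E.
apply: (IHf _ d) => //.
- move=> x y xl yl; rewrite /exchange.
  by do !case: eqP => ?; move=> ?; apply: injU => //; congruence.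
- by rewrite /exchange Ud eqxx; case: eqP.
- by rewrite dc addSn -addnS.
Qed.

(* Main.v *)
(* Between two columns the state of the algorithm is a standard filling of
   shape (b + d, b), that is a ballot path: reading the entries in increasing
   order, an entry of row 1 is an up step and an entry of row 2 a down step.
   Treating the next column inserts a down step at a uniform gap g, and then the
   row-1 entry at a uniform gap p; that entry drops to row 2 exactly when the
   path has reached height -1 before p, in which case the step first reaching -1
   is turned upwards. An induction on the last step of the path shows that
   uniform ballot paths go to uniform ballot paths, each being reached
   (b + d + 2) (b + 1) times. Summing over g and p, the cost of a column is
   n (n + 1) (n + 2) / 2 minus the sum over the times q of
   (height at q - 1) (1 + last zero before q), where n = 2 b + d; both factors
   satisfy Pascal-type recursions, which are solved with binomials and
   D(b, h) = sum_(k < b) 4^(b - 1 - k) C(2 k + h, k). This gives the complexity as a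
   single sum over b; the stated formula is a sum over 1 <= i <= d, and the two
   agree because their differences in l2 and in d are compatible. *)
Require Import Defs.
From mathcomp Require Import all_boot all_order all_algebra.
From mathcomp Require Import ring lra zify.

Set Implicit Arguments.
Unset Strict Implicit.
Unset Printing Implicit Defensive.

Import Order.TTheory GRing.Theory Num.Theory.
Local Open Scope ring_scope.

(** * The sums D(b, h) and the closed form *)

Lemma harmonicS m : harmonic m.+1 = harmonic m + (m%:R + 1)^-1.
Proof. by rewrite /harmonic big_nat_recr //= -natr1. Qed.

Lemma natr_bin (n m : nat) :
  ('C(n + m, n))%:R = (n + m)`!%:R / (n`!%:R * m`!%:R) :> rat.
Proof.
have := @bin_fact (n + m) n (leq_addr m n); rewrite addKn => <-.
by rewrite !natrM mulfK // mulf_neq0 // pnatr_eq0 -lt0n fact_gt0.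
Qed.

Lemma factSr n : (n.+1`!)%:R = (n%:R + 1) * n`!%:R :> rat.
Proof. by rewrite factS natrM -natr1. Qed.

Lemma factr_neq0 n : n`!%:R != 0 :> rat.
Proof. by rewrite pnatr_eq0 -lt0n fact_gt0. Qed.

Ltac neqs := repeat (apply/andP; split);
  first [ by [] | match goal with |- context [factorial _] => exact: factr_neq0 end
        | apply: lt0r_neq0; lra ].

Fixpoint dsum (b h : nat) : rat :=
  if b is b'.+1 then 4 * dsum b' h + 'C(2 * b' + h, b')%:R else 0.

Lemma dsum_pascal b h : dsum b.+1 h.+1 = dsum b.+1 h + dsum b h.+2.
Proof.
elim: b => [|b IHb]; first by rewrite /= !bin0; ring.
rewrite [LHS]/= -/(dsum b.+1 h.+1) IHb.
rewrite [dsum b.+2 h]/= -/(dsum b.+1 h) [dsum b.+1 h.+2]/=.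
have -> : (2 * b.+1 + h.+1 = (2 * b + h.+2).+1)%N by lia.
have -> : (2 * b.+1 + h = 2 * b + h.+2)%N by lia.
by rewrite binS natrD; ring.
Qed.

(** Unfolding [dsum b.+1] in [dsum_pascal] leaves a recursion in [h] alone; it makes the sum of
    [inner_sum] telescope. *)
Lemma dsum_rec b h :
  dsum b h.+2 = 4 * dsum b h.+1 - 4 * dsum b h
    + 'C(2 * b + h.+1, b)%:R - 'C(2 * b + h, b)%:R.
Proof. by have /= := dsum_pascal b h; move/(canRL (addKr _)) => ->; ring. Qed.

Lemma natr_binSl (l h : nat) :
  'C(2 * l + h.+1, l)%:R
    = (2 * l%:R + h%:R + 1) / (l%:R + h%:R + 1) * 'C(2 * l + h, l)%:R :> rat.
Proof.
have -> : (2 * l + h.+1 = l + (l + h).+1)%N by lia.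
have -> : (2 * l + h = l + (l + h))%N by lia.
rewrite !natr_bin addnS !factSr.
have l0 := ler0n rat l; have h0 := ler0n rat h.
by field; neqs.
Qed.

Lemma natr_binSS (l h : nat) :
  'C(2 * l.+1 + h, l.+1)%:R
    = (2 * l%:R + h%:R + 1) * (2 * l%:R + h%:R + 2)
      / ((l%:R + 1) * (l%:R + h%:R + 1)) * 'C(2 * l + h, l)%:R :> rat.
Proof.
have -> : (2 * l.+1 + h = l.+1 + (l + h).+1)%N by lia.
have -> : (2 * l + h = l + (l + h))%N by lia.
rewrite !natr_bin addnS addSn !factSr.
have l0 := ler0n rat l; have h0 := ler0n rat h.
by field; neqs.
Qed.

(** The summands are hypergeometric, so the induction step on [l] reduces to a rational identity
    between neighbouring binomials. At [h = 0] the left side vanishes, which evaluates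
    [dsum l 0]. *)
Lemma dsum_first_order l h : h%:R * dsum l h.+1 =
  2 * (h%:R + 1) * dsum l h - l%:R * 'C(2 * l + h, l)%:R.
Proof.
have h0 := ler0n rat h.
elim: l => [|l IHl]; first by rewrite /= !mulr0 mul0r subr0.
rewrite [dsum _ _]/= [dsum _ h]/= mulrDr mulrCA IHl natr_binSl natr_binSS -natr1.
have l0 := ler0n rat l.
by field; neqs.
Qed.

Lemma dsum_0 l : dsum l 0 = l%:R / 2 * 'C(2 * l, l)%:R.
Proof. by have := dsum_first_order l 0; rewrite mul0r addn0; lra. Qed.

Lemma dsum_1 l :
  dsum l 1 = ((2 * l%:R + 1) * 'C(2 * l, l)%:R - 2 ^+ (2 * l)) / 2.
Proof.
elim: l => [|l /= ->]; first by rewrite /= bin0 muln0 expr0; ring.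
have := natr_binSS l 0; rewrite !addn0 => ->.
have := natr_binSl l 0; rewrite !addn0 => ->.
have -> : (2 * l.+1 = (2 * l).+2)%N by lia.
by have l0 := ler0n rat l; rewrite !exprS; field; neqs.
Qed.

(** The Euler beta value B(l + 1, l + h + 1). It normalises [dsum] so that the recursions below have
    rational coefficients and rational inhomogeneous terms. *)
Definition beta (l h : nat) : rat :=
  l`!%:R * (l + h)`!%:R / (2 * l + h).+1`!%:R.

Lemma betaE l h : beta l h = ((2 * l + h).+1%:R * 'C(2 * l + h, l)%:R)^-1.
Proof.
have -> : (2 * l + h = l + (l + h))%N by lia.
rewrite natr_bin /beta mul2n -addnn -addnA factSr.
have l0 := ler0n rat l; have h0 := ler0n rat h.
by field; neqs.
Qed.

Lemma beta_bin l h :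
  beta l h * (2 * l%:R + h%:R + 1) * 'C(2 * l + h, l)%:R = 1.
Proof.
have l0 := ler0n rat l; have h0 := ler0n rat h.
have c0 : 'C(2 * l + h, l)%:R != 0 :> rat.
  by rewrite pnatr_eq0 -lt0n bin_gt0; lia.
by rewrite betaE; field; rewrite c0 /=; neqs.
Qed.

Lemma betaSr l h :
  beta l h.+1 = beta l h * (l%:R + h%:R + 1) / (2 * l%:R + h%:R + 2).
Proof.
have l0 := ler0n rat l; have h0 := ler0n rat h.
rewrite /beta !addnS !factSr -natr1 (natrD _ (2 * l)) (natrD _ l) (natrM _ 2).
by field; neqs.
Qed.

Lemma betaSl l h :
  beta l.+1 h = beta l h * (l%:R + 1) * (l%:R + h%:R + 1)
    / ((2 * l%:R + h%:R + 2) * (2 * l%:R + h%:R + 3)).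
Proof.
have l0 := ler0n rat l; have h0 := ler0n rat h.
rewrite /beta; have -> : (2 * l.+1 + h = (2 * l + h).+2)%N by lia.
rewrite addSn !factSr -!natr1 (natrD _ (2 * l)) (natrD _ l) (natrM _ 2).
by field; neqs.
Qed.

Definition diff_term (l h : nat) : rat := beta l h * (dsum l h.+1 - 2 * dsum l h).

Definition beta_dsum (l h : nat) : rat := beta l h * dsum l h.

(** The non-polynomial part of the mean cost of a column, see [stage_column_term]. *)
Definition column_term (l h : nat) : rat :=
  - ((2 * l%:R + h%:R) / (2 * l%:R + h%:R + 1)) + 4 * beta_dsum l h.

(* The bracket of the theorem divided by [d + 1], see [closed_form]. *)
Definition bracket (l d : nat) : rat :=
  - 2 * (\sum_(0 <= i < d.+1) diff_term l i)
  + 4 * (d%:R + 1 + l%:R) / (d%:R + 1) * diff_term l d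
  + harmonic (d + 2 * l) + 1 / 2 * harmonic l - harmonic (2 * l) - harmonic d.

Lemma bracketSr l d : bracket l d.+1 - bracket l d =
  - 2 * diff_term l d.+1 + 4 * (d%:R + 2 + l%:R) / (d%:R + 2) * diff_term l d.+1
  - 4 * (d%:R + 1 + l%:R) / (d%:R + 1) * diff_term l d
  + (2 * l%:R + d%:R + 1)^-1 - (d%:R + 1)^-1.
Proof.
rewrite /bracket big_nat_recr //= addSn !harmonicS (natrD _ d) (natrM _ 2).
have l0 := ler0n rat l; have d0 := ler0n rat d.
by field; neqs.
Qed.

Lemma beta_Nbin l h :
  'C(2 * l + h, l)%:R = (beta l h)^-1 / (2 * l%:R + h%:R + 1).
Proof.
have E := beta_bin l h.
have l0 := ler0n rat l; have h0 := ler0n rat h.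
have n0 : 2 * l%:R + h%:R + 1 != 0 :> rat by neqs.
have b0 : beta l h != 0.
  by apply/eqP => z; move: E; rewrite z !mul0r => /eqP; rewrite eq_sym oner_eq0.
by apply: (mulfI b0); apply: (mulIf n0); rewrite mulrA mulfV // mul1r mulVf // -[RHS]E; ring.
Qed.

Lemma beta_neq0 l h : beta l h != 0.
Proof. by rewrite /beta !mulf_neq0 ?invr_eq0 ?factr_neq0. Qed.

(** Together with [diff_termS], [diff_term_beta_dsum] and [beta_dsumSr], this expresses every term
    met in [bracketSl] through the single unknown [beta_dsum l d.+1]. *)
Lemma beta_dsumSl l h : beta_dsum l.+1 h =
  (l%:R + 1) * (l%:R + h%:R + 1) / ((2 * l%:R + h%:R + 2) * (2 * l%:R + h%:R + 3))
  * (4 * beta_dsum l h + (2 * l%:R + h%:R + 1)^-1).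
Proof.
have l0 := ler0n rat l; have h0 := ler0n rat h.
rewrite /beta_dsum betaSl /= beta_Nbin.
by have b0 := beta_neq0 l h; field; rewrite b0; neqs.
Qed.

Lemma diff_termS l d : diff_term l d.+1 =
  (2 * beta_dsum l d.+1 - l%:R / (2 * l%:R + d%:R + 2)) / (d%:R + 1).
Proof.
have l0 := ler0n rat l; have d0 := ler0n rat d.
have E := dsum_first_order l d.+1.
have b0 := beta_neq0 l d.+1.
rewrite /diff_term /beta_dsum; apply: (@mulfI _ (d%:R + 1)); first by neqs.
move: E; rewrite beta_Nbin -natr1 => E.
have -> : (d%:R + 1) * (beta l d.+1 * (dsum l d.+2 - 2 * dsum l d.+1)) =
  beta l d.+1 * ((d%:R + 1) * dsum l d.+2 - 2 * (d%:R + 1) * dsum l d.+1) by ring.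
by rewrite E; field; rewrite b0; neqs.
Qed.

Lemma diff_term_beta_dsum l d : diff_term l d =
  (beta_dsum l d.+1 * (2 * l%:R + d%:R + 2) / (l%:R + d%:R + 1)
   - l%:R / (2 * l%:R + d%:R + 1)) / (d%:R + 1).
Proof.
have l0 := ler0n rat l; have d0 := ler0n rat d.
have E := dsum_first_order l d.
have b0 := beta_neq0 l d.
rewrite /diff_term /beta_dsum betaSr; apply: (@mulfI _ (d%:R + 1)); first by neqs.
move: E; rewrite beta_Nbin => E.
have -> : (d%:R + 1) * (beta l d * (dsum l d.+1 - 2 * dsum l d)) =
  beta l d * ((d%:R + 1) * dsum l d.+1 - 2 * (d%:R + 1) * dsum l d) by ring.
have -> : 2 * (d%:R + 1) * dsum l d = d%:R * dsum l d.+1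
  + l%:R * ((beta l d)^-1 / (2 * l%:R + d%:R + 1)) by rewrite E; ring.
by field; rewrite b0; neqs.
Qed.

Lemma beta_dsumSr l d : beta_dsum l d.+2 =
  (l%:R + d%:R + 2) / (2 * l%:R + d%:R + 3)
  * ((2 * (d%:R + 2) * beta_dsum l d.+1 - l%:R / (2 * l%:R + d%:R + 2)) / (d%:R + 1)).
Proof.
have l0 := ler0n rat l; have d0 := ler0n rat d.
have b0 := beta_neq0 l d.+1.
have := diff_termS l d; rewrite /diff_term /beta_dsum (betaSr l d.+1) -natr1 mulrBr.
move/(canRL (subrK _)) => E.
transitivity (beta l d.+1 * dsum l d.+2 * (l%:R + d%:R + 2) / (2 * l%:R + d%:R + 3)).
  by field; neqs.
by rewrite E; field; neqs.
Qed.

(** For [d = 0] the sum in [bracket] has one term. In the step it suffices to compare the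
    differences in [d] of both sides: by [bracketSr] these contain neither sums nor harmonic
    numbers. *)
Lemma bracketSl l d : bracket l.+1 d - bracket l d = column_term l d.+1 / (d%:R + 1) ^+ 2.
Proof.
have l0 := ler0n rat l.
elim: d => [|d IHd].
  rewrite /bracket !big_nat1 /column_term !add0n !diff_term_beta_dsum beta_dsumSl.
  have -> : (2 * l.+1 = (2 * l).+2)%N by lia.
  rewrite !harmonicS -!natr1 !(natrM _ 2) /=.
  move: (beta_dsum l 1) (l%:R) l0 => z x x0.
  by field; neqs.
have d0 := ler0n rat d.
suff E : (bracket l.+1 d.+1 - bracket l.+1 d) - (bracket l d.+1 - bracket l d)
    = column_term l d.+2 / (d%:R + 2) ^+ 2 - column_term l d.+1 / (d%:R + 1) ^+ 2.
  rewrite -natr1 (_ : d%:R + 1 + 1 = d%:R + 2); last by ring.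
  move: IHd E; move: (column_term l d.+1 / _) (column_term l d.+2 / _) => u v.
  move: (bracket l.+1 d.+1) (bracket l.+1 d) (bracket l d.+1) (bracket l d) => a b c e IHd E.
  by rewrite -(subrK u v) -E -IHd; ring.
rewrite (bracketSr l.+1) (bracketSr l) /column_term (diff_termS l.+1) (diff_termS l).
rewrite (diff_term_beta_dsum l.+1) (diff_term_beta_dsum l) beta_dsumSr beta_dsumSl.
rewrite -[d.+2%:R]natr1 -[d.+1%:R]natr1 -[l.+1%:R]natr1.
move: (beta_dsum l d.+1) => z.
move: (l%:R) (d%:R) l0 d0 {IHd} => x y x0 y0.
by field; neqs.
Qed.

Lemma bracket0 d : bracket 0 d = 0.
Proof.
rewrite /bracket big1 => [|i _]; last by rewrite /diff_term /=; ring.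
have -> : harmonic 0 = 0 by rewrite /harmonic big_geq.
by rewrite addn0 /diff_term /=; ring.
Qed.

Lemma bracketE l d :
  bracket l d = (\sum_(0 <= b < l) column_term b d.+1) / (d%:R + 1) ^+ 2.
Proof.
elim: l => [|l IHl]; first by rewrite bracket0 big_geq // mul0r.
by rewrite big_nat_recr //= mulrDl -IHl -bracketSl addrC subrK.
Qed.

(** * Evaluation of the sums in the stated formula *)

Lemma natr_bin_neq0 n m : (m <= n)%N -> 'C(n, m)%:R != 0 :> rat.
Proof. by move=> le; rewrite pnatr_eq0 -lt0n bin_gt0. Qed.

Lemma bin_ratio_beta l i :
  'C(i + l, i)%:R / ('C(i + 2 * l, i)%:R * (1 + i%:R + 2 * l%:R))
    = 'C(2 * l, l)%:R * beta l i.
Proof.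
have -> : (2 * l = l + l)%N by lia.
rewrite !natr_bin /beta.
have -> : (2 * l + i = i + (l + l))%N by lia.
rewrite factSr (natrD _ i) (natrD _ l) (addnC l i).
have l0 := ler0n rat l; have i0 := ler0n rat i.
by field; neqs.
Qed.

(* The first difference of [dsum l h / 2 ^ h]. *)
Definition ddiff (l i : nat) : rat := (dsum l i.+1 - 2 * dsum l i) / 2 ^+ i.+1.

(** By [dsum_rec] the second difference of [dsum l h / 2 ^ h] is an explicit binomial, which up to a
    factor depending only on [l] is the summand; the sum telescopes. *)
Lemma inner_sum l i : (0 < l)%N ->
  \sum_(1 <= j < i.+1)
     2 ^- j * 'C(j + 2 * l, j)%:R / ('C(j + l, j)%:R * (j%:R + 2 * l%:R))
  = 2 / (l%:R * 'C(2 * l, l)%:R) * (ddiff l i - ddiff l 0).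
Proof.
move=> l_gt0; have l0 : 0 < l%:R :> rat by rewrite ltr0n.
have c0 := @natr_bin_neq0 (2 * l) l ltac:(lia).
elim: i => [|i IHi]; first by rewrite big_geq // subrr mulr0.
have i0 := ler0n rat i.
have T : 'C(i.+1 + 2 * l, i.+1)%:R / ('C(i.+1 + l, i.+1)%:R * (i.+1%:R + 2 * l%:R))
   = 'C(2 * l + i, l)%:R / ((l%:R + i%:R + 1) * 'C(2 * l, l)%:R) :> rat.
  have -> : (2 * l + i = l + (l + i))%N by lia.
  have -> : (2 * l = l + l)%N by lia.
  rewrite !natr_bin.
  have -> : (i.+1 + (l + l) = (l + (l + i)).+1)%N by lia.
  have -> : (i.+1 + l = (l + i).+1)%N by lia.
  rewrite !factSr -!natr1 !(natrD _ l).
  by field; neqs.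
rewrite big_nat_recr //= IHi -[2 ^- i.+1 * _ / _]mulrA T /ddiff dsum_rec natr_binSl.
have e0 : 2 ^+ i != 0 :> rat by rewrite expf_neq0.
rewrite !exprS -!natr1.
by field; rewrite c0 e0 /=; neqs.
Qed.

(** By [inner_sum] the double sum splits into a sum of [diff_term] and a multiple of the first
    single sum, and this multiple cancels the first summand of the formula. *)
Lemma closed_form l d : (0 < l)%N ->
  (- 1 - d%:R + (d%:R + 1) * 2 ^+ (2 * l) / 'C(2 * l, l)%:R)
    * (\sum_(1 <= i < d.+1)
         2 ^+ i * 'C(i + l, i)%:R
         / ('C(i + 2 * l, i)%:R * (1 + i%:R + 2 * l%:R)))
  + 2 ^+ (d + 2) * l%:R * (1 + d%:R + l%:R) * 'C(d + l, d)%:R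
      / ('C(d + 2 * l, d)%:R * (1 + d%:R + 2 * l%:R))
    * (\sum_(1 <= i < d.+1)
         2 ^- i * 'C(i + 2 * l, i)%:R
         / ('C(i + l, i)%:R * (i%:R + 2 * l%:R)))
  - 2 * (d%:R + 1) * l%:R
    * (\sum_(1 <= i < d.+1)
         2 ^+ i * 'C(i + l, i)%:R
         / ('C(i + 2 * l, i)%:R * (1 + i%:R + 2 * l%:R))
         * (\sum_(1 <= j < i.+1)
              2 ^- j * 'C(j + 2 * l, j)%:R
              / ('C(j + l, j)%:R * (j%:R + 2 * l%:R))))
  + 2 ^+ (2 * l) * (d%:R + 1) / ('C(2 * l, l)%:R * (2 * l%:R + 1))
  + 2 ^+ (d + 1) * (1 + d%:R + l%:R) * 'C(d + l, d)%:R
      / ('C(d + 2 * l, d)%:R * 'C(2 * l, l)%:R * (1 + d%:R + 2 * l%:R))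
    * (- 2 ^+ (2 * l) + 'C(2 * l, l)%:R)
  - (d%:R + 1) / (2 * l%:R + 1)
  + (d%:R + 1) * harmonic (d + 2 * l)
  + 1 / 2 * (d%:R + 1) * harmonic l
  - (d%:R + 1) * harmonic (2 * l)
  - (d%:R + 1) * harmonic d = (d%:R + 1) * bracket l d.
Proof.
move=> l_gt0; have l0 : 0 < l%:R :> rat by rewrite ltr0n.
have d0 := ler0n rat d.
have c0 := @natr_bin_neq0 (2 * l) l ltac:(lia).
pose s i : rat := 2 ^+ i * ('C(2 * l, l)%:R * beta l i).
have sE i : 2 ^+ i * 'C(i + l, i)%:R
    / ('C(i + 2 * l, i)%:R * (1 + i%:R + 2 * l%:R)) = s i.
  by rewrite -mulrA bin_ratio_beta.
have -> : \sum_(1 <= i < d.+1) 2 ^+ i * 'C(i + l, i)%:R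
    / ('C(i + 2 * l, i)%:R * (1 + i%:R + 2 * l%:R)) = \sum_(1 <= i < d.+1) s i.
  by apply: eq_bigr => i _.
have -> : \sum_(1 <= i < d.+1) 2 ^+ i * 'C(i + l, i)%:R
    / ('C(i + 2 * l, i)%:R * (1 + i%:R + 2 * l%:R))
    * (\sum_(1 <= j < i.+1) 2 ^- j * 'C(j + 2 * l, j)%:R
              / ('C(j + l, j)%:R * (j%:R + 2 * l%:R)))
  = l%:R^-1 * (\sum_(1 <= i < d.+1) diff_term l i)
    - 2 / (l%:R * 'C(2 * l, l)%:R) * ddiff l 0 * (\sum_(1 <= i < d.+1) s i).
  rewrite !mulr_sumr -sumrB; apply: eq_bigr => i _.
  rewrite sE inner_sum // /s /ddiff /diff_term exprS.
  have e0 : 2 ^+ i != 0 :> rat by rewrite expf_neq0.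
  by field; rewrite c0 e0 /=; neqs.
rewrite inner_sum //.
have -> : 2 ^+ (d + 2) * l%:R * (1 + d%:R + l%:R) * 'C(d + l, d)%:R
      / ('C(d + 2 * l, d)%:R * (1 + d%:R + 2 * l%:R))
    = 4 * l%:R * (1 + d%:R + l%:R) * s d.
  have b0 := @natr_bin_neq0 (d + 2 * l) d ltac:(lia).
  by rewrite -sE exprD; field; rewrite b0 /=; neqs.
have -> : 2 ^+ (d + 1) * (1 + d%:R + l%:R) * 'C(d + l, d)%:R
      / ('C(d + 2 * l, d)%:R * 'C(2 * l, l)%:R * (1 + d%:R + 2 * l%:R))
    = 2 * (1 + d%:R + l%:R) * s d / 'C(2 * l, l)%:R.
  have b0 := @natr_bin_neq0 (d + 2 * l) d ltac:(lia).
  by rewrite -sE exprD; field; rewrite b0 c0 /=; neqs.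
rewrite /bracket [\sum_(0 <= i < _) _]big_ltn //.
move: (harmonic (d + 2 * l)) (harmonic l) (harmonic (2 * l)) (harmonic d) => h1 h2 h3 h4.
move: (\sum_(1 <= i < d.+1) s i) (\sum_(1 <= i < d.+1) diff_term l i) => S1 SG.
(* This value makes the total coefficient of [S1] vanish: [4 * (d + 1) / C(2l, l)] times it is the
   opposite of the coefficient of the first summand. *)
have E0 : ddiff l 0 = ('C(2 * l, l)%:R - 2 ^+ (2 * l)) / 4.
  by rewrite /ddiff dsum_1 dsum_0; field.
have G0 : diff_term l 0 = ('C(2 * l, l)%:R - 2 ^+ (2 * l))
    / (2 * (2 * l%:R + 1) * 'C(2 * l, l)%:R).
  rewrite /diff_term betaE dsum_1 dsum_0 addn0 -natr1 (natrM _ 2).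
  by field; rewrite c0 /=; neqs.
rewrite E0 G0 /s /ddiff /diff_term exprS.
have e0 : 2 ^+ d != 0 :> rat by rewrite expf_neq0.
move: (2 ^+ d) ('C(2 * l, l)%:R) (2 ^+ (2 * l)) (dsum l d.+1) (dsum l d) (beta l d)
  e0 c0 {E0 G0 sE s} => e c f Y X b e0 c0.
move: (l%:R) (d%:R) l0 d0 => x y x0 y0.
by field; rewrite c0 e0 /=; neqs.
Qed.

(** * Ballot paths and their transformation *)

(* Bit lists are read from the smallest entry on: [true] for row 1, an up step.
   The path starts at height [h]; [hits] tells whether it reaches height -1, and
   [flip] turns upwards the first step that does. *)
Fixpoint hits (h : nat) (s : seq bool) : bool :=
  match s with
  | [::] => false
  | true :: s' => hits h.+1 s'
  | false :: s' => if h is h'.+1 then hits h' s' else true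
  end.

Fixpoint flip (h : nat) (s : seq bool) : seq bool :=
  match s with
  | [::] => [::]
  | true :: s' => true :: flip h.+1 s'
  | false :: s' => if h is h'.+1 then false :: flip h' s' else true :: s'
  end.

Definition ups (s : seq bool) := count id s.
Definition downs (s : seq bool) := count negb s.

Definition ins (g : nat) (c : bool) (s : seq bool) := take g s ++ c :: drop g s.

Definition step (s : seq bool) (p : nat) : seq bool :=
  if hits 0 (take p s) then flip 0 (take p s) ++ false :: drop p s
  else ins p true s.

(** If the path reaches -1 after [u] up steps, the entry makes [u] moves to the right, one down, and
    then passes the later down steps before [p]. The first down steps, up to the one reaching -1,
    number [u + 1], so the total is the number of down steps before [p]. *)
Definition step_cost (s : seq bool) (p : nat) : nat :=
  if hits 0 (take p s) then downs (take p s) else ups (take p s).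

Lemma size_flip h s : size (flip h s) = size s.
Proof. by elim: s h => //= -[] s IHs [|h] //=; rewrite IHs. Qed.

Lemma hits_rcons h s e :
  hits h (rcons s e) = hits h s || (~~ e && (downs s == h + ups s)%N).
Proof.
rewrite /downs /ups; case: e; elim: s h => [|[] s IHs] [|h] //=; rewrite ?IHs //=;
  by rewrite ?add0n ?add1n ?addSn ?addnS ?eqSS.
Qed.

Lemma ups_rcons s e : ups (rcons s e) = (ups s + e)%N.
Proof. by rewrite /ups -cats1 count_cat /= addn0. Qed.

Lemma downs_rcons s e : downs (rcons s e) = (downs s + ~~ e)%N.
Proof. by rewrite /downs -cats1 count_cat /= addn0. Qed.

Lemma ups_downs s : (ups s + downs s = size s)%N.
Proof. exact: count_predC. Qed.

Lemma flip_nhits h s : ~~ hits h s -> flip h s = s.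
Proof. by elim: s h => //= -[] s IHs [|h] //= ?; rewrite IHs. Qed.

Lemma flip_rcons h s e : flip h (rcons s e) =
  rcons (flip h s) (e || (~~ hits h s && (downs s == h + ups s)%N)).
Proof.
rewrite /downs /ups; case: e; elim: s h => [|[] s IHs] [|h] //=; rewrite ?IHs ?orbF ?andbF //=;
  by rewrite ?add0n ?add1n ?addSn ?addnS ?eqSS.
Qed.

Lemma ins_rcons g c s e : (g <= size s)%N ->
  ins g c (rcons s e) = rcons (ins g c s) e.
Proof.
move=> le; rewrite /ins -cats1 takel_cat // drop_cat; case: ltngtP le => // [lt|->] _.
  by rewrite -cats1 -catA.
by rewrite subnn drop0 drop_size -cats1 -catA.
Qed.

Lemma ins_size c s : ins (size s) c s = rcons s c.
Proof. by rewrite /ins take_size drop_size cats1. Qed.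

Lemma size_ins g c s : size (ins g c s) = (size s).+1.
Proof. by rewrite /ins size_cat /= addnS -size_cat cat_take_drop. Qed.

Lemma ups_ins g c s : ups (ins g c s) = (ups s + c)%N.
Proof.
by rewrite /ups -{2}(cat_take_drop g s) !count_cat /=; lia.
Qed.

Lemma downs_ins g c s : downs (ins g c s) = (downs s + ~~ c)%N.
Proof.
by rewrite /downs -{2}(cat_take_drop g s) !count_cat /=; lia.
Qed.

Lemma take_rcons (T : Type) p (s : seq T) e : (p <= size s)%N -> take p (rcons s e) = take p s.
Proof. by move=> le; rewrite -cats1 takel_cat. Qed.

Lemma step_rcons s e p : (p <= size s)%N -> step (rcons s e) p = rcons (step s p) e.
Proof.
move=> le; rewrite /step take_rcons // ins_rcons //; case: ifP => // _.
rewrite -cats1 drop_cat; case: ltngtP le => // [lt|->] _.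
  by rewrite cats1 -rcons_cons -rcons_cat.
by rewrite subnn drop0 drop_size -cats1 -catA.
Qed.

(** At the last gap the two branches of [step] merge, since [flip] fixes a path that does not reach
    -1. *)
Lemma step_size s : step s (size s) = rcons (flip 0 s) (~~ hits 0 s).
Proof.
rewrite /step take_size drop_size ins_size; case: ifP => h.
  by rewrite cats1.
by rewrite flip_nhits ?h.
Qed.

Lemma step_cost_rcons s e p : (p <= size s)%N -> step_cost (rcons s e) p = step_cost s p.
Proof. by move=> le; rewrite /step_cost take_rcons. Qed.

(** * Sums over ballot paths and uniformity *)

(* The sum of [phi] over the ballot paths of length [n] ending at height [h]. *)
Fixpoint bsum (n h : nat) (phi : seq bool -> rat) : rat :=
  if n is n'.+1 then
    (if h is h'.+1 then bsum n' h' (fun P => phi (rcons P true)) else 0)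
    + bsum n' h.+1 (fun P => phi (rcons P false))
  else if h == 0%N then phi [::] else 0.

Definition ballot n h (P : seq bool) :=
  [/\ size P = n, ~~ hits 0 P & ups P = (downs P + h)%N].

Lemma ballot_up n h P : ballot n h P -> ballot n.+1 h.+1 (rcons P true).
Proof.
case=> s nh u; split; first by rewrite size_rcons s.
  by rewrite hits_rcons negb_or nh.
by rewrite ups_rcons downs_rcons u /=; lia.
Qed.

Lemma ballot_down n h P : ballot n h.+1 P -> ballot n.+1 h (rcons P false).
Proof.
case=> s nh u; split; first by rewrite size_rcons s.
  by rewrite hits_rcons negb_or nh /= add0n u; apply/eqP; lia.
by rewrite ups_rcons downs_rcons u /=; lia.
Qed.

Lemma eq_bsum n h phi psi : (forall P, ballot n h P -> phi P = psi P) ->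
  bsum n h phi = bsum n h psi.
Proof.
elim: n h phi psi => [|n IHn] [|h] phi psi E //=.
- exact: E.
- by congr (_ + _); apply: IHn => P bP; exact: (E _ (ballot_down bP)).
- by congr (_ + _); apply: IHn => P bP;
    [exact: (E _ (ballot_up bP)) | exact: (E _ (ballot_down bP))].
Qed.

Lemma bsumD n h phi psi :
  bsum n h (fun P => phi P + psi P) = bsum n h phi + bsum n h psi.
Proof.
elim: n h phi psi => [|n IHn] [|h] phi psi //=; rewrite ?addr0 ?add0r ?IHn //.
by ring.
Qed.

Lemma bsumZ n h a phi : bsum n h (fun P => a * phi P) = a * bsum n h phi.
Proof.
elim: n h phi => [|n IHn] [|h] phi //=; rewrite ?mulr0 ?IHn ?add0r //.
by ring.
Qed.

Lemma bsum_high n h phi : (n < h)%N -> bsum n h phi = 0.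
Proof.
elim: n h phi => [|n IHn] [|h] phi //= lt.
by rewrite !IHn ?addr0 //; lia.
Qed.

Lemma bsumS n h phi : bsum n.+1 h phi =
  (if h is h'.+1 then bsum n h' (fun P => phi (rcons P true)) else 0)
    + bsum n h.+1 (fun P => phi (rcons P false)).
Proof. by []. Qed.

Lemma bsum0 h phi : bsum 0 h phi = if h == 0%N then phi [::] else 0.
Proof. by []. Qed.

Opaque bsum.

(* By the last step of the path, [stepsum] reduces to the sum over all up-step
   insertions ([upsum]) and over the down-step insertions, split according to
   whether the new path stays nonnegative ([nhsum]) or not ([hitsum]). *)
Definition upsum n h phi := bsum n h (fun P => \sum_(g < n.+1) phi (ins g true P)).
Definition nhsum n h phi := bsum n h (fun P =>
  \sum_(g < n.+1) if hits 0 (ins g false P) then 0 else phi (ins g false P)).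
Definition hitsum n h phi := bsum n h (fun P =>
  \sum_(g < n.+1) if hits 0 (ins g false P) then phi (flip 0 (ins g false P)) else 0).
Definition stepsum n h phi := bsum n h (fun P =>
  \sum_(g < n.+1) \sum_(p < n.+2) phi (step (ins g false P) p)).

(** The gap at the end of the path is set apart; every other gap lies before the last step, so there
    an insertion commutes with removing that step. *)
Lemma bsum_sum_rcons n h (F : nat -> seq bool -> rat) :
  bsum n.+1 h (fun P => \sum_(g < n.+2) F g P)
  = bsum n.+1 h (F n.+1)
    + ((if h is h'.+1 then bsum n h' (fun P => \sum_(g < n.+1) F g (rcons P true)) else 0)
      + bsum n h.+1 (fun P => \sum_(g < n.+1) F g (rcons P false))).
Proof.
transitivity (bsum n.+1 h (F n.+1) + bsum n.+1 h (fun P => \sum_(g < n.+1) F g P)).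
  by rewrite -bsumD; apply: eq_bsum => P _; rewrite big_ord_recr addrC.
by rewrite [X in _ + X = _]bsumS.
Qed.

Lemma hits_take h s p : hits h (take p s) -> hits h s.
Proof. by elim: s h p => [|[] s IHs] [|h] [|p] //= /IHs. Qed.

Lemma upsumS n h phi : upsum n.+1 h phi = bsum n.+1 h (fun P => phi (rcons P true))
  + ((if h is h'.+1 then upsum n h' (fun P => phi (rcons P true)) else 0)
  + upsum n h.+1 (fun P => phi (rcons P false))).
Proof.
have inE e h' : bsum n h' (fun P => \sum_(g < n.+1) phi (ins g true (rcons P e)))
  = upsum n h' (fun P => phi (rcons P e)).
  apply: eq_bsum => P [sP _ _]; apply: eq_bigr => g _.
  by rewrite ins_rcons // sP -ltnS.
rewrite /upsum (bsum_sum_rcons _ _ (fun g P => phi (ins g true P))).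
congr (_ + _).
  by apply: eq_bsum => P [sP _ _]; rewrite -sP ins_size.
by case: h => [|h]; rewrite !inE.
Qed.

Lemma hits_downs h s : (h + ups s < downs s)%N -> hits h s.
Proof.
rewrite /ups /downs; elim: s h => [|[] s IHs] [|h] //= lt; apply: IHs; lia.
Qed.

Lemma hits_ins_rcons n h P g e : ballot n h P ->
  hits 0 (rcons (ins g false P) e)
    = hits 0 (ins g false P) || (~~ e && (h == 1%N)).
Proof.
case=> _ _ u; rewrite hits_rcons ups_ins downs_ins u /= addn0 addn1.
by congr (_ || (_ && _)); rewrite add0n -addn1 eqn_add2l eq_sym.
Qed.

Lemma hits_ins0 n P g : ballot n 0 P -> hits 0 (ins g false P).
Proof.
by case=> _ _ u; apply: hits_downs; rewrite ups_ins downs_ins u /=; lia.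
Qed.

Lemma ballot_hits_down n h P : ballot n h P -> hits 0 (rcons P false) = (h == 0%N).
Proof.
case=> _ /negbTE nh u; rewrite hits_rcons nh u /= add0n.
by rewrite -[X in X == _]addn0 eqn_add2l eq_sym.
Qed.

Lemma nhsum0 n phi : nhsum n 0 phi = 0.
Proof.
rewrite /nhsum -[RHS](mul0r (bsum n 0 (fun=> 0))) -bsumZ; apply: eq_bsum => P bP.
by rewrite mul0r big1 // => g _; rewrite (hits_ins0 _ bP).
Qed.

(** Deleting any down step of a ballot path leaves a ballot path. A path of length [n.+1] ending at
    [h] thus arises once from each of its down steps, and the factor is their number. *)
Lemma nhsumE n h phi :
  nhsum n h.+1 phi = ((n%:R - h.+1%:R) / 2 + 1) * bsum n.+1 h phi.
Proof.
elim: n h phi => [|n IHn] h phi.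
  by rewrite /nhsum bsumS !bsum0 /=; case: h => [|[|h]]; rewrite ?bsum0 /=; by field.
rewrite {1}/nhsum (bsum_sum_rcons _ _
  (fun g P => if hits 0 (ins g false P) then 0 else phi (ins g false P))).
have inE e h' : ((h' != 1%N) || e) ->
  bsum n h' (fun P => \sum_(g < n.+1) if hits 0 (ins g false (rcons P e)) then 0
     else phi (ins g false (rcons P e))) = nhsum n h' (fun P => phi (rcons P e)).
  move=> he; apply: eq_bsum => P bP; apply: eq_bigr => g _; case: (bP) => sP _ _.
  rewrite ins_rcons ?sP -1?ltnS // (hits_ins_rcons _ _ bP).
  by case: e he => /=; rewrite ?orbF // => /negbTE ->; rewrite orbF.
rewrite !inE ?orbT // IHn.
have -> : bsum n.+1 h.+1 (fun P => if hits 0 (ins n.+1 false P) then 0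
    else phi (ins n.+1 false P)) = bsum n.+1 h.+1 (fun P => phi (rcons P false)).
  apply: eq_bsum => P bP; case: (bP) => sP _ _.
  by rewrite -sP ins_size (ballot_hits_down bP).
rewrite [bsum n.+2 h phi]bsumS; case: h {inE} => [|h].
  by rewrite nhsum0 -!natr1; field.
by rewrite IHn -!natr1; field.
Qed.

(** The three terms at height 0: the inserted step is last and is turned itself; the path has
    reached -1 before its last step; that last step is the first to reach -1 and is turned. *)
Lemma hitsumS n h phi : hitsum n.+1 h phi =
  if h is h'.+1 then hitsum n h' (fun P => phi (rcons P true))
                     + hitsum n h.+1 (fun P => phi (rcons P false))
  else bsum n.+1 0 (fun P => phi (rcons P true))
       + (hitsum n 1 (fun P => phi (rcons P false))
          + nhsum n 1 (fun P => phi (rcons P true))).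
Proof.
rewrite {1}/hitsum (bsum_sum_rcons _ _
  (fun g P => if hits 0 (ins g false P) then phi (flip 0 (ins g false P)) else 0)).
have inE e h' : ((h' != 1%N) || e) ->
  bsum n h' (fun P => \sum_(g < n.+1) if hits 0 (ins g false (rcons P e))
     then phi (flip 0 (ins g false (rcons P e))) else 0)
  = hitsum n h' (fun P => phi (rcons P e)).
  move=> he; apply: eq_bsum => P bP; apply: eq_bigr => g _; case: (bP) => sP _ _.
  rewrite ins_rcons ?sP -1?ltnS // (hits_ins_rcons _ _ bP).
  have -> : hits 0 (ins g false P) || ~~ e && (h' == 1%N) = hits 0 (ins g false P).
    by case: e he => /=; rewrite ?orbF // => /negbTE ->; rewrite orbF.
  by case: ifP => // hi; rewrite flip_rcons hi orbF.
case: h => [|h].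
  rewrite add0r -bsumD; congr (_ + _); apply: eq_bsum => P bP; case: (bP) => sP nh u.
    rewrite -sP ins_size (ballot_hits_down bP) flip_rcons nh u add0n addn0 eqxx /=.
    by rewrite flip_nhits ?eqxx.
  rewrite -big_split /=; apply: eq_bigr => g _.
  rewrite ins_rcons ?sP -1?ltnS // (hits_ins_rcons _ _ bP) orbT flip_rcons.
  rewrite ups_ins downs_ins u addn0 add0n eqxx andbT.
  by case: ifP => hi /=; rewrite ?addr0 ?add0r // flip_nhits ?hi.
rewrite !inE ?orbT // [X in X + _](_ : _ = 0) ?add0r //.
rewrite -[RHS](mul0r (bsum n.+1 h.+1 (fun=> 0))) -bsumZ; apply: eq_bsum => P bP.
by case: (bP) => sP _ _; rewrite mul0r -sP ins_size (ballot_hits_down bP).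
Qed.

(** The insertions of an up step are not uniform by themselves; with the turned paths added, each
    path is reached once more than it has up steps. *)
Lemma upsum_hitsum n h phi : upsum n h phi + hitsum n h phi =
  ((n%:R + h%:R) / 2 + 2) * bsum n.+1 h.+1 phi.
Proof.
elim: n h phi => [|n IHn] h phi.
  rewrite /upsum /hitsum bsumS !bsum0 /=; case: h => [|h] /=; last by ring.
  by rewrite !big_ord_recr !big_ord0 /=; ring.
rewrite upsumS hitsumS [bsum n.+2 _ phi]bsumS.
have E h' psi : upsum n h' psi = ((n%:R + h'%:R) / 2 + 2) * bsum n.+1 h'.+1 psi
   - hitsum n h' psi by rewrite -IHn; ring.
case: h => [|h]; rewrite !E ?nhsumE -!natr1; by field.
Qed.

Lemma stepsumE n h phi : stepsum n h phi =
  ((n%:R + h%:R) / 2 + 2) * ((n%:R - h%:R) / 2 + 1) * bsum n.+2 h phi.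
Proof.
elim: n h phi => [|n IHn] h phi.
  rewrite /stepsum !bsumS !bsum0 /=; case: h => [|h] /=.
    rewrite !big_ord_recr !big_ord0 /= /step /ins /=; rewrite ?bsumS ?bsum0 /=; ring.
  by case: h => [|[|h]]; rewrite ?bsumS ?bsum0 /=; by field.
(* The cases: [p] at the end, where the new last step tells whether -1 was reached; only [g] at the
   end, where a final down step is appended after an up insertion; and both gaps before the last
   step of [P]. *)
have -> : stepsum n.+1 h phi =
   hitsum n.+1 h (fun P => phi (rcons P false)) + nhsum n.+1 h (fun P => phi (rcons P true))
   + (upsum n.+1 h (fun P => phi (rcons P false)) +
   ((if h is h'.+1 then stepsum n h' (fun P => phi (rcons P true)) else 0)
    + stepsum n h.+1 (fun P => phi (rcons P false)))).
  have inE e h' : bsum n h' (fun P => \sum_(g < n.+1) \sum_(p < n.+2)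
       phi (step (ins g false (rcons P e)) p)) = stepsum n h' (fun P => phi (rcons P e)).
    apply: eq_bsum => P [sP _ _]; apply: eq_bigr => g _; apply: eq_bigr => p _.
    by rewrite ins_rcons ?step_rcons ?size_ins ?sP -1?ltnS.
  transitivity (bsum n.+1 h (fun P => \sum_(g < n.+2) phi (step (ins g false P) n.+2))
    + bsum n.+1 h (fun P => \sum_(g < n.+2) \sum_(p < n.+2) phi (step (ins g false P) p))).
    rewrite -bsumD; apply: eq_bsum => P _; rewrite -big_split; apply: eq_bigr => g _.
    by rewrite [LHS]big_ord_recr /= addrC.
  congr (_ + _).
    rewrite -bsumD; apply: eq_bsum => P [sP _ _]; rewrite -big_split; apply: eq_bigr => g _.
    have := step_size (ins g false P); rewrite size_ins sP => -> /=.
    by case: ifP => hi; rewrite ?addr0 ?add0r // flip_nhits ?hi.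
  rewrite (bsum_sum_rcons _ _ (fun g P => \sum_(p < n.+2) phi (step (ins g false P) p))).
  congr (_ + _); last by case: h => [|h]; rewrite !inE.
  apply: eq_bsum => P [sP nh _]; apply: eq_bigr => p _.
  have le : (p <= size P)%N by rewrite sP -ltnS.
  have := ins_size false P; rewrite sP => ->; rewrite step_rcons // /step.
  case: ifP => // hi.
  by rewrite (hits_take hi) in nh.
(* The first two cases contribute exactly the two sums paired in [upsum_hitsum], for the same
   function. *)
have E := upsum_hitsum n.+1 h (fun P => phi (rcons P false)).
rewrite [bsum n.+3 h phi]bsumS.
have {}E : upsum n.+1 h (fun P => phi (rcons P false)) =
  ((n.+1%:R + h%:R) / 2 + 2) * bsum n.+2 h.+1 (fun P => phi (rcons P false))
  - hitsum n.+1 h (fun P => phi (rcons P false)) by rewrite -E; ring.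
rewrite E !IHn; case: h {E} => [|h]; rewrite ?nhsumE ?nhsum0 ?IHn -!natr1; by field.
Qed.

(** * The cost of a column *)

(* Height [h] after [2 * b + h] steps, of which [b] are down steps. *)
Lemma ballot_recursion (X Y S : nat -> nat -> rat) :
  (forall n h, (n < h)%N -> X n h = 0) ->
  (forall n h, X n.+1 h = (if h is h'.+1 then X n h' else 0) + X n h.+1 + S n.+1 h) ->
  Y 0%N 0%N = X 0%N 0%N ->
  (forall b, Y b.+1 0%N = Y b 1%N + S (2 * b.+1)%N 0%N) ->
  (forall h, Y 0%N h.+1 = Y 0%N h + S h.+1 h.+1) ->
  (forall b h, Y b.+1 h.+1 = Y b.+1 h + Y b h.+2 + S (2 * b.+1 + h.+1)%N h.+1) ->
  forall b h, X (2 * b + h)%N h = Y b h.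
Proof.
move=> X0 XS Y00 Yb0 Y0h Ybh b h.
move En: (2 * b + h)%N => n; elim: n b h En => [|n IHn] b h En.
  by have [-> ->] : b = 0%N /\ h = 0%N by lia.
rewrite XS; case: h En => [|h]; case: b => [|b] En; first by lia.
- by rewrite Yb0 add0r (IHn b 1%N) -?En ?addn0 //; lia.
- by rewrite Y0h (IHn 0%N) ?(X0 n h.+2) ?addr0; [congr (_ + S _ _) | |]; lia.
- by rewrite Ybh (IHn b.+1) ?(IHn b) ?En //; lia.
Qed.

Lemma sum_ordr n : \sum_(i < n) i%:R = n%:R * (n%:R - 1) / 2 :> rat.
Proof.
elim: n => [|n IHn]; first by rewrite big_ord0; field.
by rewrite big_ord_recr /= IHn -natr1; field.
Qed.

Definition nballot n h : rat := bsum n h (fun=> 1).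

Lemma nballotS n h : nballot n.+1 h =
  (if h is h'.+1 then nballot n h' else 0) + nballot n h.+1.
Proof. by rewrite /nballot bsumS. Qed.

Lemma nballotE b h :
  nballot (2 * b + h) h = (h%:R + 1) / (b%:R + h%:R + 1) * 'C(2 * b + h, b)%:R.
Proof.
apply: (@ballot_recursion nballot
  (fun b h => (h%:R + 1) / (b%:R + h%:R + 1) * 'C(2 * b + h, b)%:R) (fun _ _ => 0)).
- by move=> n k lt; rewrite /nballot bsum_high.
- by move=> n k; rewrite nballotS addr0.
- by rewrite /nballot bsum0 bin0 /=; field.
- move=> {h} {}b; have b0 := ler0n rat b.
  have := natr_binSS b 0; rewrite !addn0 => ->.
  have := natr_binSl b 0; rewrite !addn0 => ->.
  by rewrite -!natr1; field; neqs.
- move=> {b} k; have k0 := ler0n rat k.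
  by rewrite !bin0 -natr1; field; neqs.
- move=> {h} {}b k; have b0 := ler0n rat b; have k0 := ler0n rat k.
  by rewrite natr_binSl !natr_binSS !natr_binSl -!natr1; field; neqs.
Qed.

Definition nhits n h : rat := bsum n h (fun P =>
  \sum_(g < n.+1) (hits 0 (ins g false P))%:R).

(** This is [upsum_hitsum] for the constant function 1, where the up insertions count [n + 1] per
    path. *)
Lemma nhitsE b h : nhits (2 * b + h) h = 'C(2 * b + h.+1, b)%:R.
Proof.
set n := (2 * b + h)%N.
have := upsum_hitsum n h (fun=> 1); rewrite -/(nballot _ _).
have -> : upsum n h (fun=> 1) = (n%:R + 1) * nballot n h.
  by rewrite /nballot -bsumZ; apply: eq_bsum => P _; rewrite sumr_const card_ord mulr1 natr1.
have -> : hitsum n h (fun=> 1) = nhits n h.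
  by apply: eq_bsum => P _; apply: eq_bigr => g _; case: ifP.
move/(canRL (addKr _)) => ->.
have -> : n.+1 = (2 * b + h.+1)%N by rewrite addnS.
have b0 := ler0n rat b; have h0 := ler0n rat h.
rewrite !nballotE natr_binSl /n -!natr1 (natrD _ (2 * b)) (natrM _ 2).
by field; neqs.
Qed.

Definition pair_cost (P : seq bool) g p : nat :=
  (downs (take g P) + step_cost (ins g false P) p)%N.

Definition stage n h : rat := bsum n h (fun P =>
  \sum_(g < n.+1) \sum_(p < n.+2) (pair_cost P g p)%:R).

(** The last term collects the pairs with a gap at the end. For [p] at the end the cost is the
    number of up steps, lowered by [h - 1] when -1 is reached: there the down steps are counted
    instead. *)
Lemma stageS n h : stage n.+1 h =
  (if h is h'.+1 then stage n h' else 0) + stage n h.+1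
  + (3 / 2 * (n%:R + 1) * (n%:R + 2) * nballot n.+1 h - (h%:R - 1) * nhits n.+1 h).
Proof.
have inE e h' : bsum n h' (fun P => \sum_(g < n.+1) \sum_(p < n.+2)
     (pair_cost (rcons P e) g p)%:R) = stage n h'.
  apply: eq_bsum => P [sP _ _]; apply: eq_bigr => g _; apply: eq_bigr => p _.
  by rewrite /pair_cost take_rcons ?ins_rcons ?step_cost_rcons ?size_ins ?sP -1?ltnS.
transitivity (bsum n.+1 h (fun P => \sum_(g < n.+2) (pair_cost P g n.+2)%:R)
  + bsum n.+1 h (fun P => \sum_(g < n.+2) \sum_(p < n.+2) (pair_cost P g p)%:R)).
  rewrite -bsumD; apply: eq_bsum => P _; rewrite -big_split; apply: eq_bigr => g _.
  by rewrite [LHS]big_ord_recr /= addrC.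
rewrite (bsum_sum_rcons _ _ (fun g P => \sum_(p < n.+2) (pair_cost P g p)%:R)).
rewrite addrA addrC; congr (_ + _); first by case: h => [|h]; rewrite !inE.
rewrite -mulNr -!bsumZ -!bsumD; apply: eq_bsum => P [sP nh u].
have -> : \sum_(p < n.+2) (pair_cost P n.+1 p)%:R =
    (n%:R + 2) * (downs P)%:R + \sum_(p < n.+2) (ups (take p P))%:R :> rat.
  have -> : (n%:R + 2) * (downs P)%:R = \sum_(p < n.+2) (downs P)%:R :> rat.
    by rewrite sumr_const card_ord -mulr_natl -!natr1; ring.
  rewrite -big_split; apply: eq_bigr => p _ /=.
  have le : (p <= size P)%N by rewrite sP -ltnS.
  have := ins_size false P; rewrite sP /pair_cost => ->.
  rewrite step_cost_rcons // take_oversize ?sP // natrD; congr (_ + _%:R).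
  by rewrite /step_cost; case: ifP => // hi; rewrite (hits_take hi) in nh.
have -> : \sum_(g < n.+2) (pair_cost P g n.+2)%:R =
    \sum_(g < n.+2) (downs (take g P))%:R + (n%:R + 2) * ((downs P)%:R + h%:R)
    - (h%:R - 1) * (\sum_(g < n.+2) (hits 0 (ins g false P))%:R) :> rat.
  have -> : (n%:R + 2) * ((downs P)%:R + h%:R) =
      \sum_(g < n.+2) ((downs P)%:R + h%:R) :> rat.
    by rewrite sumr_const card_ord -mulr_natl -!natr1; ring.
  rewrite mulr_sumr -sumrN -!big_split; apply: eq_bigr => g _ /=.
  rewrite /pair_cost natrD -addrA; congr (_ + _).
  have sI : size (ins g false P) = n.+2 by rewrite size_ins sP.
  rewrite /step_cost take_oversize ?sI // downs_ins ups_ins u addn0 /=.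
  by case: ifP => _ /=; rewrite ?addn0 natrD /=; ring.
(* The prefix of length [g] has [g] steps, so the down counts over [g] and the up counts over [p]
   add up to a number independent of the path. *)
have -> : (\sum_(g < n.+2) (downs (take g P))%:R : rat) =
    (n%:R + 1) * (n%:R + 2) / 2 - \sum_(g < n.+2) (ups (take g P))%:R.
  apply: (canRL (addrK _)); rewrite -big_split /=.
  transitivity (\sum_(g < n.+2) g%:R : rat).
    apply: eq_bigr => g _; rewrite -natrD addnC ups_downs size_take sP.
    case: ltnP => // ge; congr (1 *+ _); apply/eqP.
    by rewrite eqn_leq ge -ltnS ltn_ord.
  by rewrite sum_ordr -!natr1; field.
have sz : n%:R + 1 = 2 * (downs P)%:R + h%:R :> rat.
  by rewrite natr1 -natrM -natrD -sP -ups_downs u; congr (1 *+ _); lia.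
move: (\sum_(g < n.+2) (ups (take g P))%:R) => A.
move: (\sum_(g < n.+2) (hits 0 (ins g false P))%:R) => B.
have -> : (downs P)%:R = (n%:R + 1 - h%:R) / 2 :> rat by rewrite sz; field.
by field.
Qed.

Lemma stageE b h : stage (2 * b + h) h =
  let n := 2 * b%:R + h%:R in
  n * (n + 1) * (n + 2) / 2 * nballot (2 * b + h) h
  - ('C(2 * b + h.+1, b)%:R * ((h%:R + 1) * (n + 2) / 2 - 2 * (n + 1))
     + 8 * dsum b h.+1).
Proof.
(* The cubic grows by [3 / 2 * (n + 1) * (n + 2)] from [n] to [n + 1], so subtracting [stage] leaves
   the source [(h - 1) * nhits] alone. *)
pose X n h := n%:R * (n%:R + 1) * (n%:R + 2) / 2 * nballot n h - stage n h.
pose Y b h : rat := 'C(2 * b + h.+1, b)%:R * ((h%:R + 1) * (2 * b%:R + h%:R + 2) / 2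
    - 2 * (2 * b%:R + h%:R + 1)) + 8 * dsum b h.+1.
have E : X (2 * b + h)%N h = Y b h; last first.
  by move: E; rewrite /X /Y natrD natrM => <-; rewrite /=; ring.
pose S n h := (h%:R - 1) * nhits n h.
apply: (@ballot_recursion X Y S).
- by move=> n k lt; rewrite /X /nballot /stage !bsum_high // mulr0 subrr.
- by move=> n k; rewrite /X stageS /S nballotS -!natr1; case: k => [|k]; field.
- rewrite /X /Y /stage bsum0 /= !big_ord_recr !big_ord0 /= /pair_cost /=.
  by rewrite /step_cost /=.
- move=> {h} {}b; have b0 := ler0n rat b; rewrite /Y /S.
  have -> : nhits (2 * b.+1) 0 = 'C(2 * b.+1 + 1, b.+1)%:R.
    by rewrite -nhitsE addn0.
  rewrite dsum_pascal dsum_0 !natr_binSl !addn0.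
  have := natr_binSS b 0; rewrite !addn0 => ->.
  by rewrite -!natr1; field; neqs.
- move=> {b} k; have k0 := ler0n rat k; rewrite /Y /S.
  by have := nhitsE 0 k.+1; rewrite muln0 => ->; rewrite !bin0 /= -!natr1; field; neqs.
- move=> {h} {}b k; have b0 := ler0n rat b; have k0 := ler0n rat k.
  rewrite /Y /S nhitsE dsum_pascal.
  by rewrite !natr_binSl !natr_binSS ?natr_binSl -!natr1; field; neqs.
Qed.

(** The factor [(n + 1) * (n + 2) * nballot] counts the triples of a path and two gaps; what
    multiplies it is the mean cost of a column. *)
Lemma stage_column_term b h : stage (2 * b + h) h =
  let n := 2 * b%:R + h%:R in
  (n + 1) * (n + 2) * nballot (2 * b + h) h
  * ((n - 1) / 2 - 2 / (h%:R + 1) * column_term b h.+1).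
Proof.
have b0 := ler0n rat b; have h0 := ler0n rat h.
have c0 : 'C(2 * b + h, b)%:R != 0 :> rat.
  by rewrite pnatr_eq0 -lt0n bin_gt0; lia.
rewrite stageE nballotE /column_term /beta_dsum betaE natr_binSl.
rewrite -!natr1 (natrD _ (2 * b)) (natrM _ 2) -!natr1 /=.
by field; rewrite c0 /=; neqs.
Qed.

(** * Lehmer codes and the total cost of the bit algorithm *)

(* Lehmer codes: the [i]-th letter, counted from 0, is at most [i]. *)
Fixpoint codes (n : nat) : seq (seq nat) :=
  if n is n'.+1 then [seq rcons c g | c <- codes n', g <- iota 0 n] else [:: [::]].

Lemma sum_codesS n (G : seq nat -> rat) :
  \sum_(c <- codes n.+1) G c = \sum_(c <- codes n) \sum_(g < n.+1) G (rcons c g).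
Proof.
rewrite big_allpairs_dep; apply: eq_bigr => c _.
by rewrite -[iota 0 n.+1]/(index_iota 0 n.+1) big_mkord.
Qed.

Lemma size_codes n c : c \in codes n -> size c = n.
Proof.
elim: n c => [|n IHn] c; first by rewrite inE => /eqP ->.
by case/allpairsPdep => c' [g [/IHn sc _ ->]]; rewrite size_rcons sc.
Qed.

Lemma sum_codes1 n : \sum_(c <- codes n) 1 = n`!%:R :> rat.
Proof.
elim: n => [|n IHn]; first by rewrite big_seq1.
rewrite sum_codesS factSr -IHn mulr_sumr; apply: eq_bigr => c _.
by rewrite sumr_const card_ord natr1 mulr1.
Qed.

Definition bstep (st : seq bool * nat) (x : bool * nat) : seq bool * nat :=
  if x.1 then (step st.1 x.2, st.2 + step_cost st.1 x.2)%N
  else (ins x.2 false st.1, st.2 + downs (take x.2 st.1))%N.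

Definition brun (rs : seq bool) (c : seq nat) := foldl bstep ([::], 0%N) (zip rs c).

(** Columns are treated from right to left: first the [d] columns without a second cell, then in
    each of the [l] others the cell of row 2 before that of row 1. *)
Definition row_flags d l := nseq d true ++ flatten (nseq l [:: false; true]).

Lemma size_row_flags d l : size (row_flags d l) = (2 * l + d)%N.
Proof. by rewrite size_cat size_nseq size_flatten /shape map_nseq sumn_nseq addnC. Qed.

Lemma row_flagsS d l : row_flags d l.+1 = rcons (rcons (row_flags d l) false) true.
Proof. by rewrite /row_flags -addn1 nseqD flatten_cat /= catA -!cats1 -!catA. Qed.

Lemma brun_rcons rs c r g : size rs = size c ->
  brun (rcons rs r) (rcons c g) = bstep (brun rs c) (r, g).
Proof. by move=> sz; rewrite /brun -!cats1 zip_cat // foldl_cat. Qed.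

(** In a single row the algorithm is insertion sort: a letter of the code is the number of entries
    passed. *)
Lemma brun_nseq d c : c \in codes d -> brun (nseq d true) c = (nseq d true, sumn c).
Proof.
elim: d c => [|d IHd] c; first by rewrite inE => /eqP ->.
case/allpairsPdep => c' [g [c'd]]; rewrite mem_iota => /= gd ->.
have E : true :: nseq d true = rcons (nseq d true) true.
  by rewrite -cats1 -[true :: _]/(nseq d.+1 true) -addn1 nseqD.
rewrite E.
rewrite brun_rcons ?size_nseq ?(size_codes c'd) // IHd // /bstep /=.
have nh p h : ~~ hits h (take p (nseq d true)).
  by elim: d p h {IHd c'd gd E} => [|d IHd] [|p] h //=.
rewrite /step /step_cost (negbTE (nh _ _)); congr pair.
  rewrite /ins take_nseq ?drop_nseq // -[true :: _]/(nseq (d - g).+1 true).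
  by rewrite -nseqD addnS subnKC // -addn1 nseqD.
by rewrite sumn_rcons /ups take_nseq // count_nseq mul1n.
Qed.

Lemma bsum_diag n phi : bsum n n phi = phi (nseq n true).
Proof.
elim: n phi => [|n IHn] phi; first by rewrite bsum0.
by rewrite bsumS IHn bsum_high // addr0 -cats1 -[true :: [::]]/(nseq 1 true) -nseqD addn1.
Qed.

(** The product of the hook lengths of the shape [(b + d, b)]; [hookprod_nballot] is then the hook
    length formula. *)
Fixpoint hookprod d b : rat :=
  if b is b'.+1 then hookprod d b' * ((b'%:R + d%:R + 2) * (b'%:R + 1)) else d`!%:R.

(** Uniformity: by [stepsumE] each new column multiplies the number of codes leading to a path by
    [(b + d + 2) * (b + 1)], whatever the path. *)
Lemma sum_brun_state d b phi :
  \sum_(c <- codes (2 * b + d)) phi (brun (row_flags d b) c).1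
    = hookprod d b * bsum (2 * b + d) d phi.
Proof.
elim: b phi => [|b IHb] phi.
  rewrite /= bsum_diag /row_flags cats0 muln0 add0n -sum_codes1 mulr_suml big_seq [RHS]big_seq.
  by apply: eq_bigr => c cd; rewrite brun_nseq // mul1r.
have E : (2 * b.+1 + d = (2 * b + d).+2)%N by lia.
rewrite E !sum_codesS.
transitivity (hookprod d b * stepsum (2 * b + d) d phi).
  rewrite /stepsum -IHb big_seq [RHS]big_seq; apply: eq_bigr => c /size_codes sc.
  apply: eq_bigr => g _; rewrite row_flagsS; apply: eq_bigr => p _.
  by rewrite !brun_rcons ?size_rcons ?size_row_flags ?sc // /bstep.
rewrite stepsumE /= (natrD _ (2 * b)) (natrM _ 2).
by field.
Qed.

Lemma hookprod_nballot d b : hookprod d b * nballot (2 * b + d) d = (2 * b + d)`!%:R.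
Proof. by rewrite -sum_codes1 -(sum_brun_state d b (fun=> 1)). Qed.

Lemma sum_brun_cost d l :
  \sum_(c <- codes (2 * l + d)) (brun (row_flags d l) c).2%:R
  = (2 * l + d)`!%:R * (d%:R * (d%:R - 1) / 4 + l%:R * (l%:R - 1) / 2
     + l%:R * (d%:R - 1) / 2
     - 2 / (d%:R + 1) * (\sum_(0 <= b < l) column_term b d.+1)).
Proof.
have d0 := ler0n rat d.
elim: l => [|b IHb].
  rewrite big_geq // /row_flags cats0 muln0 add0n big_seq.
  under eq_bigr => c cd do rewrite brun_nseq //=.
  rewrite -big_seq; transitivity (d`!%:R * (d%:R * (d%:R - 1) / 4) : rat); last by ring.
  elim: d {d0} => [|d IHd]; first by rewrite big_seq1 /=; ring.
  rewrite sum_codesS factSr.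
  transitivity (\sum_(c <- codes d) ((d%:R + 1) * (sumn c)%:R
      + (d%:R + 1) * d%:R / 2 * 1) : rat).
    apply: eq_bigr => c _; under eq_bigr => g _ do rewrite sumn_rcons natrD.
    rewrite big_split /= sumr_const card_ord sum_ordr -mulr_natl -!natr1.
    by ring.
  rewrite big_split /= -!mulr_sumr IHd sum_codes1 -natr1.
  by field.
have E : (2 * b.+1 + d = (2 * b + d).+2)%N by lia.
rewrite E !sum_codesS.
have N0 : (2 * b + d).+1%:R = 2 * b%:R + d%:R + 1 :> rat.
  by rewrite -natr1 natrD natrM.
(* The earlier cost is repeated for every pair of gaps; the cost of the new column depends only on
   the path reached, so [sum_brun_state] applies to it. *)
transitivity ((2 * b%:R + d%:R + 1) * (2 * b%:R + d%:R + 2)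
    * (\sum_(c <- codes (2 * b + d)) (brun (row_flags d b) c).2%:R)
    + hookprod d b * stage (2 * b + d) d).
  rewrite /stage -sum_brun_state mulr_sumr -big_split big_seq [RHS]big_seq.
  apply: eq_bigr => c /size_codes sc /=.
  have -> : (2 * b%:R + d%:R + 1) * (2 * b%:R + d%:R + 2)
      * (brun (row_flags d b) c).2%:R
    = \sum_(g < (2 * b + d).+1) \sum_(p < (2 * b + d).+2)
      (brun (row_flags d b) c).2%:R :> rat.
    rewrite !sumr_const !card_ord -mulrnA -[RHS]mulr_natl natrM -[_.+2%:R]natr1 N0; ring.
  rewrite -big_split; apply: eq_bigr => g _; rewrite -big_split; apply: eq_bigr => p _.
  rewrite row_flagsS !brun_rcons ?size_rcons ?size_row_flags ?sc //=.
  by rewrite -natrD addnA.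
rewrite IHb stage_column_term [hookprod d b * _](_ : _ =
  (2 * b%:R + d%:R + 1) * (2 * b%:R + d%:R + 2) * (hookprod d b * nballot (2 * b + d) d)
  * ((2 * b%:R + d%:R - 1) / 2 - 2 / (d%:R + 1) * column_term b d.+1));
  last by rewrite /=; ring.
rewrite hookprod_nballot big_nat_recr //= !factSr -!natr1 (natrD _ (2 * b)) (natrM _ 2).
move: (column_term b d.+1) (\sum_(0 <= i < b) _) => k K.
by field; neqs.
Qed.

(** * The two rows as sorted lists *)

Local Close Scope ring_scope.

(* The slides on the contents of the rows from the inserted cell on: [rowins]
   for row 2, [colins] for row 1 followed by its possible drop to row 2. In
   [colins k R1 R2], [R2] starts below the moving entry [k] and [R1] to its right. *)
Fixpoint rowins (k : nat) (R : seq nat) : seq nat * nat :=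
  match R with
  | [::] => ([:: k], 0)
  | v :: R' => if k < v then (k :: R, 0)
               else let: (Q, e) := rowins k R' in (v :: Q, e.+1)
  end.

Fixpoint colins (k : nat) (R1 R2 : seq nat) : seq nat * seq nat * nat :=
  match R1, R2 with
  | [::], [::] => ([:: k], [::], 0)
  | [::], v :: R2' => if k < v then ([:: k], R2, 0)
      else let: (Q, e) := rowins k R2' in ([:: v], Q, e.+1)
  | u :: R1', [::] => if k < u then (k :: R1, [::], 0)
      else let: (Q1, Q2, e) := colins k R1' [::] in (u :: Q1, Q2, e.+1)
  | u :: R1', v :: R2' => if k < minn u v then (k :: R1, R2, 0)
      else if u < v then
        let: (Q1, Q2, e) := colins k R1' R2' in (u :: Q1, v :: Q2, e.+1)
      else let: (Q, e) := rowins k R2' in (v :: R1, Q, e.+1)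
  end.

Definition rank (k : nat) (A : seq nat) := find (ltn k) A.
Definition vins k (A : seq nat) := take (rank k A) A ++ k :: drop (rank k A) A.

Lemma rowins_all_gt k R : all (ltn k) R -> rowins k R = (k :: R, 0).
Proof. by case: R => //= v R /andP[-> _]. Qed.

Lemma all_mask (T : eqType) (p : pred T) m (s : seq T) : all p s -> all p (mask m s).
Proof. by move/allP => ap; apply/allP => x /mem_mask /ap. Qed.

Lemma path_ltn_all a A : path ltn a A -> all (ltn a) A.
Proof. by rewrite (path_sortedE ltn_trans) => /andP[]. Qed.

(** The entries of [A] before [rank k A] are smaller than [k] and the others larger, so [k] passes
    exactly the set bits before its rank. *)
Lemma rowins_mask k t A : size t = size A -> sorted ltn A -> k \notin A ->
  rowins k (mask t A) =
    (mask (take (rank k A) t ++ true :: drop (rank k A) t) (vins k A),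
     count id (take (rank k A) t)).
Proof.
rewrite /vins /rank; elim: A t => [|a A IHA] [|b t] //= [sz] pA.
rewrite inE negb_or => /andP[ka kA].
have [lt|ge] := ltnP k a.
  rewrite /=; apply: rowins_all_gt; apply: (@all_mask _ _ (b :: t) (a :: A)).
  rewrite /= lt; apply: sub_all (path_ltn_all pA) => x; exact: ltn_trans.
rewrite /=; have := IHA t sz (path_sorted pA) kA; case: b => /= -> //.
by rewrite ltnNge ge.
Qed.

Lemma colins_stop k Up R1 R2 : all (ltn^~ k) Up -> all (ltn k) R1 -> all (ltn k) R2 ->
  colins k (Up ++ R1) R2 = (Up ++ k :: R1, R2, size Up).
Proof.
elim: Up R2 => [|u Up IHUp] R2 /=.
  case: R1 => [|u R1] _; first by case: R2 => [|v R2] //= _ /andP[-> _].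
  by case: R2 => [|v R2] /= /andP[ku _] => [|/andP[kv _]]; rewrite ?leq_min ku ?kv.
case/andP => uk aU a1; case: R2 => [|v R2] /=.
  by move=> _; rewrite ltnNge ltnW // IHUp.
case/andP => kv a2; rewrite leq_min [k < u]ltnNge (ltnW uk) (ltn_trans uk kv) /=.
by rewrite IHUp.
Qed.

(** [step] and, in [wcost], [step_cost] for a path already at height [h]: the induction on the
    sorted list in [colins_mask] consumes the path from its start. *)
Definition wstep h (t : seq bool) p :=
  if hits h (take p t) then flip h (take p t) ++ false :: drop p t
  else take p t ++ true :: drop p t.
Definition wcost h (t : seq bool) p :=
  if hits h (take p t) then downs (take p t) else h + ups (take p t).

Lemma wstep0 t p : wstep 0 t p = step t p.
Proof. by []. Qed.

Lemma wcost0 t p : wcost 0 t p = step_cost t p.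
Proof. by []. Qed.

Lemma mask_vins_false k t A : size t = size A ->
  mask (take (rank k A) t ++ false :: drop (rank k A) t) (vins k A) = mask t A.
Proof.
move=> sz; rewrite /vins; move: (rank k A) => p.
have sp : size (take p t) = size (take p A) by rewrite !size_take sz.
by rewrite mask_cat //= -mask_cat // !cat_take_drop.
Qed.

(* [Up] holds the row-1 entries to the right of the moving entry that are
   smaller than every entry of [A]: its length is the height of the path. *)
Lemma colins_mask k Up t A : size t = size A -> sorted ltn (Up ++ A) ->
  all (ltn^~ k) Up -> k \notin A ->
  let s := wstep (size Up) t (rank k A) in
  colins k (Up ++ mask t A) (mask (map negb t) A) =
    (Up ++ mask s (vins k A), mask (map negb s) (vins k A),
     wcost (size Up) t (rank k A)).
Proof.
rewrite /vins /rank; elim: A Up t => [|a A IHA] Up [|b t] //=.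
  by move=> _ _ aU _; rewrite colins_stop // /wcost /wstep /= addn0.
case=> sz sA aU; rewrite inE negb_or => /andP[ka kA].
have [lt|ge] := ltnP k a.
  have ak : all (ltn k) (a :: A).
    rewrite /= lt; move: sA; rewrite (sorted_pairwise ltn_trans) pairwise_cat /=.
    by case/and3P => _ _ /andP[] /sub_all -> // x; exact: ltn_trans.
  rewrite /wstep /wcost /= addn0 -[if b then _ else _]/(mask (b :: t) (a :: A)).
  rewrite -[if ~~ b then _ else _]/(mask (map negb (b :: t)) (a :: A)).
  by rewrite colins_stop //; exact: all_mask.
have {ge ka} lt : a < k by rewrite ltn_neqAle eq_sym ka.
(* If [a] is in row 1, it joins [Up]: one step up. *)
case: b.
  have := IHA (rcons Up a) t sz.
  rewrite -cats1 -!catA /= sA all_cat aU /= lt => /(_ isT isT kA).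
  rewrite size_cat addn1 => ->; rewrite /wstep /wcost /= addnS addSn.
  by case: ifP => _ /=; rewrite -?catA.
(* At height 0 with [a] in row 2, every remaining row-1 entry exceeds [a], so [k] is exchanged with
   [a]. This is the turned step; what follows is an insertion in row 2. *)
case: Up sA aU => [|u Up] /= sA aU.
  have := rowins_mask (t := map negb t) _ (path_sorted sA) kA; rewrite size_map => /(_ sz) E.
  have am : all (ltn a) (mask t A) by apply/all_mask/path_ltn_all.
  have Ec : count id (take (rank k A) (map negb t)) = downs (take (rank k A) t).
    by rewrite -map_take count_map.
  rewrite /wstep /wcost /= map_cat map_take /= map_drop -/(rank k A) -/(vins k A) -Ec.
  rewrite mask_vins_false //.
  case: (mask t A) am => [|u R1] /= => [_|/andP[au _]].
    by rewrite ltnNge (ltnW lt) /= E.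
  rewrite leq_min [k < a]ltnNge (ltnW lt) andbF /= ltnNge (ltnW au) /= E.
  by [].
(* At positive height the first entry [u] of [Up] is smaller than [a]: [k] moves right past the
   column of [u] and [a], and the height drops by one. *)
case/andP: aU => uk aU.
have ua : u < a.
  move: sA; rewrite (path_sortedE ltn_trans) => /andP[/allP-> //].
  by rewrite mem_cat inE eqxx orbT.
have sU : sorted ltn (Up ++ A).
  have s1 : sorted ltn (Up ++ a :: A) by exact: path_sorted sA.
  apply: (@subseq_sorted _ ltn ltn_trans _ (Up ++ a :: A)) => //.
  by apply: cat_subseq => //; exact: subseq_cons.
rewrite leq_min [k < u]ltnNge (ltnW uk) ua /= (IHA Up t sz sU aU kA).
rewrite /wstep /wcost /=.
by case: ifP.
Qed.

Definition abstep (st : seq nat * seq nat * nat) (x : bool * nat) :=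
  let: (R1, R2, e) := st in
  if x.1 then let: (Q1, Q2, e') := colins x.2 R1 R2 in (Q1, Q2, e + e')
  else let: (Q, e') := rowins x.2 R2 in (R1, Q, e + e').

Definition abrun (rs : seq bool) (w : seq nat) :=
  foldl abstep ([::], [::], 0) (zip rs w).

(** * Words and their Lehmer codes *)

(* The insertion gaps of a word: a Lehmer code. *)
Definition code (w : seq nat) : seq nat :=
  [seq count (ltn^~ (nth 0 w i)) (take i w) | i <- iota 0 (size w)].

Lemma code_rcons w x : code (rcons w x) = rcons (code w) (count (ltn^~ x) w).
Proof.
rewrite /code size_rcons -addn1 iotaD map_cat cats1 /= add0n nth_rcons ltnn eqxx.
rewrite -[in take _ (rcons _ _)]cats1 take_size_cat //; congr rcons.
apply/eq_in_map => i; rewrite mem_iota => /= lt.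
by rewrite nth_rcons lt (take_rcons _ (ltnW lt)).
Qed.

Lemma sorted_rank k A : sorted ltn A -> k \notin A -> rank k A = count (ltn^~ k) A.
Proof.
rewrite /rank; elim: A => //= a A IHA pA; rewrite inE negb_or => /andP[ka kA].
have [lt|ge] := ltnP k a; last first.
  by rewrite IHA ?(path_sorted pA) // ltn_neqAle eq_sym ka ge.
rewrite ltnNge ltnW //= add0n; apply/esym/eqP; rewrite -leqn0 leqNgt -has_count.
apply/hasPn => x xA /=; rewrite -leqNgt ltnW // (ltn_trans lt) //.
exact: (allP (path_ltn_all pA)).
Qed.

Lemma perm_vins k A : perm_eq (vins k A) (k :: A).
Proof. by rewrite /vins perm_catC /= perm_cons perm_catC cat_take_drop. Qed.

Lemma sorted_vins k A : sorted ltn A -> k \notin A -> sorted ltn (vins k A).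
Proof.
rewrite /vins /rank; elim: A => //= a A IHA pA; rewrite inE negb_or => /andP[ka kA].
case: ltnP => [lt|ge] /=; first by rewrite lt.
have lt : a < k by rewrite ltn_neqAle eq_sym ka.
rewrite (path_sortedE ltn_trans) IHA ?(path_sorted pA) // andbT.
have := perm_vins k A; rewrite /vins /rank => /perm_all ->.
by rewrite /= lt path_ltn_all.
Qed.

Lemma size_step s p : size (step s p) = (size s).+1.
Proof.
rewrite /step; case: ifP => _; last exact: size_ins.
by rewrite size_cat size_flip /= addnS -size_cat cat_take_drop.
Qed.

Lemma abrun_rcons rs w r k : size rs = size w ->
  abrun (rcons rs r) (rcons w k) = abstep (abrun rs w) (r, k).
Proof. by move=> sz; rewrite /abrun -!cats1 zip_cat // foldl_cat. Qed.

(** Invariant: [A] lists the entries read so far in increasing order and [s] marks those of row 1.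
    The rank of the next entry in [A] is the next letter of the code, so [rowins_mask] and
    [colins_mask] carry the invariant on. *)
Lemma abrun_code rs w : uniq w -> size rs = size w ->
  let: (s, e) := brun rs (code w) in
  exists A, [/\ sorted ltn A, perm_eq A w, size s = size A
    & abrun rs w = (mask s A, mask (map negb s) A, e)].
Proof.
elim/last_ind: w rs => [|w k IHw] rs; first by case: rs => //= _ _; exists [::].
case/lastP: rs => [|rs r]; rewrite ?size_rcons // rcons_uniq => /andP[kw uw] [sz].
rewrite code_rcons brun_rcons ?size_map ?size_iota // abrun_rcons //.
have := IHw rs uw sz; case: (brun rs (code w)) => s e [A [sA pA zs ->]].
have kA : k \notin A by rewrite (perm_mem pA).
rewrite -(permP pA) -sorted_rank //.
have pv : perm_eq (vins k A) (rcons w k).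
  by rewrite (permPl (perm_vins k A)) perm_sym perm_rcons perm_cons perm_sym.
have zv : size (vins k A) = (size A).+1 by rewrite (perm_size (perm_vins k A)).
rewrite /bstep /=; case: r => /=; exists (vins k A).
  split; rewrite ?sorted_vins ?size_step ?zs //.
  have := @colins_mask k [::] s A zs sA isT kA; rewrite /= => ->.
  by rewrite wstep0 wcost0.
split; rewrite ?sorted_vins ?size_ins ?zs //.
rewrite rowins_mask ?size_map // -map_take -map_drop count_map.
by rewrite /ins mask_vins_false // map_cat.
Qed.

Lemma perm_permutations_rcons (A : seq nat) : uniq A -> 0 < size A ->
  perm_eq (permutations A) [seq rcons w x | x <- A, w <- permutations (rem x A)].
Proof.
move=> uA A0; apply: uniq_perm; rewrite ?permutations_uniq //.
  apply: allpairs_uniq_dep => //; first by move=> x _; exact: permutations_uniq.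
  by move=> [x w] [y v] _ _ /= /rcons_inj [-> ->].
move=> w; rewrite mem_permutations; apply/idP/allpairsPdep => [pw|[x [v [xA]]]].
  case/lastP: w pw => [|w x] pw; first by rewrite -(perm_size pw) in A0.
  have xA : x \in A by rewrite -(perm_mem pw) mem_rcons inE eqxx.
  exists x, w; split=> //; rewrite mem_permutations -(perm_cons x).
  by rewrite -perm_rcons (perm_trans pw) // perm_to_rem.
rewrite mem_permutations => pv ->.
rewrite perm_rcons (perm_trans (_ : perm_eq _ (x :: rem x A))) ?perm_cons //.
by rewrite perm_sym perm_to_rem.
Qed.

Lemma map_count_sorted A : sorted ltn A ->
  [seq count (ltn^~ x) A | x <- A] = iota 0 (size A).
Proof.
elim: A => //= a A IHA pA; have /allP aA := path_ltn_all pA.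
rewrite ltnn add0n (iotaDl 1 0) -IHA ?(path_sorted pA) // -map_comp; congr cons.
  apply/eqP; rewrite -leqn0 leqNgt -has_count; apply/hasPn => x /aA /= ax.
  by rewrite -leqNgt ltnW.
by apply/eq_in_map => x /aA /= ->.
Qed.

Local Open Scope ring_scope.

(** Removing the last letter [x] leaves a permutation of [rem x A], with arbitrary code by
    induction, while the number of smaller entries of [A] takes each value below [size A] once. *)
Lemma sum_permutations_code (A : seq nat) (G : seq nat -> rat) : sorted ltn A ->
  \sum_(w <- permutations A) G (code w) = \sum_(c <- codes (size A)) G c.
Proof.
move: {2}(size A) (erefl (size A)) => n En.
elim: n A En G => [|n IHn] A En G sA.
  by rewrite (size0nil En) /= /permutations /= !big_seq1.
have uA : uniq A by apply: sorted_uniq sA; [exact: ltn_trans | exact: ltnn].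
rewrite (perm_big _ (perm_permutations_rcons uA _)) ?En // big_allpairs_dep sum_codesS.
rewrite exchange_big /=.
have sr x : x \in A -> size (rem x A) = n by move=> xA; rewrite size_rem // En.
transitivity (\sum_(x <- A) \sum_(c <- codes n) G (rcons c (count (ltn^~ x) A))).
  rewrite big_seq [RHS]big_seq; apply: eq_bigr => x xA.
  rewrite -{1}(sr x xA).
  rewrite -(IHn _ (sr x xA) (fun c => G (rcons c (count (ltn^~ x) A)))); last first.
    by apply: subseq_sorted ltn_trans _ _ _ sA; exact: rem_subseq.
  rewrite big_seq [RHS]big_seq; apply: eq_bigr => w.
  rewrite mem_permutations => pw; rewrite code_rcons (permP pw) count_rem xA /= ltnn.
  by rewrite subn0.
rewrite exchange_big [RHS]exchange_big /=; apply: eq_bigr => c _.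
transitivity (\sum_(i <- [seq count (ltn^~ x) A | x <- A]) G (rcons c i)).
  by rewrite big_map.
by rewrite map_count_sorted // En -[iota 0 n.+1]/(index_iota 0 n.+1) big_mkord.
Qed.

(** * Sliding in a two-row diagram *)

Local Close Scope ring_scope.

Definition rowseg (U : filling) i j n := [seq U (i, x) | x <- iota j n].

Lemma exchange_cells la (U : filling) c d : {in cells la &, injective U} ->
  c \in cells la -> d \in cells la ->
  {in cells la, exchange U (U c) (U d) =1
     fun x => if x == c then U d else if x == d then U c else U x}.
Proof.
move=> injU cl dl x xl; rewrite /exchange.
by rewrite !(inj_in_eq injU).
Qed.

Lemma exchange_inj la (U : filling) k m : {in cells la &, injective U} ->
  {in cells la &, injective (exchange U k m)}.
Proof.
move=> injU x y xl yl; rewrite /exchange.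
by do !case: eqP => ?; move=> ?; apply: injU => //; congruence.
Qed.

Lemma slideS la (U : filling) f c : {in cells la &, injective U} -> c \in cells la ->
  slide la (U c) f.+1 U =
    if ~~ corner la c && (min_neighbour la U c < U c) then
      let: (U', e) := slide la (U c) f (exchange U (U c) (min_neighbour la U c)) in
      (U', e.+1)
    else (U, 0).
Proof. by move=> injU cl; rewrite /= /moves (cell_ofP injU cl). Qed.

Section TwoRows.
Variables (l1 l2 : nat).
Hypothesis le21 : l2 <= l1.
Let la := [:: l1; l2].

Lemma mem_row1 j : ((1, j) \in cells la) = (0 < j <= l1).
Proof. by rewrite mem_cells. Qed.
Lemma mem_row2 j : ((2, j) \in cells la) = (0 < j <= l2).
Proof. by rewrite mem_cells. Qed.
Lemma mem_row3 i j : ((i.+3, j) \in cells la) = false.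
Proof. by rewrite mem_cells /= nth_nil; case: j. Qed.

Lemma slide_row2 R f (U : filling) k j :
  {in cells la &, injective U} -> 0 < j -> j + size R = l2 -> size R <= f ->
  rowseg U 2 j (size R).+1 = k :: R ->
  let: (U', e) := slide la k f U in
  [/\ {in cells la &, injective U'}, rowins k R = (rowseg U' 2 j (size R).+1, e)
    & {in cells la, forall c, ~~ ((c.1 == 2) && (j <= c.2)) -> U' c = U c}].
Proof.
elim: R f U j => [|v R IHR] f U j injU j0 jR lef.
  case=> Uk; rewrite addn0 in jR.
  have cl : (2, j) \in cells la by rewrite mem_row2 j0; lia.
  have -> : slide la k f U = (U, 0).
    case: f {lef} => // f; rewrite -Uk slideS // /corner mem_row3.
    by have -> : (right_of (2, j) \in cells la) = false by rewrite mem_row2 /=; lia.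
  by rewrite /rowseg /= Uk; split.
case: f lef => // f lef [Uk Uv UR].
have cl : (2, j) \in cells la by rewrite mem_row2 j0; lia.
have dl : (2, j.+1) \in cells la by rewrite mem_row2 /=; move: jR => /=; lia.
have cd : (2, j.+1) != (2, j) :> nat * nat by rewrite xpair_eqE /=; lia.
rewrite -{1}Uk slideS // /corner /min_neighbour /= dl mem_row3 /= minnn /right_of /= Uk Uv.
have [lt|ge] := ltnP k v.
  by rewrite ltnNge ltnW //= /rowseg /= Uk Uv UR; split.
have {ge} lt : v < k.
  rewrite ltn_neqAle ge andbT; apply: contra_neq cd => vk.
  by apply: injU => //; rewrite Uk Uv.
rewrite lt; set U1 := exchange U k v.
have U1E : {in cells la, U1 =1 fun x =>
    if x == (2, j) then v else if x == (2, j.+1) then k else U x}.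
  by rewrite /U1 -Uk -Uv; exact: exchange_cells.
have R1 : rowseg U1 2 j.+1 (size R).+1 = k :: R.
  rewrite /rowseg /= U1E // (negbTE cd) eqxx; congr cons.
  rewrite -[RHS]UR; apply/eq_in_map => x; rewrite mem_iota => xr.
  have xl : (2, x) \in cells la by rewrite mem_row2; move: jR xr => /=; lia.
  by rewrite U1E // !xpair_eqE /=; case: eqP => [|_]; [lia|]; case: eqP => [|_]; [lia|].
have := IHR f U1 j.+1 (exchange_inj injU) isT _ lef R1.
case: (slide la k f U1) => U' e; rewrite -jR /= addSnnS => /(_ erefl) [injU' -> un].
split=> //.
  have -> : rowseg U' 2 j (size R).+2 = U' (2, j) :: rowseg U' 2 j.+1 (size R).+1 by [].
  by rewrite un ?U1E ?eqxx ?[k < v]ltnNge ?(ltnW lt) //= ltnn.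
move=> c cin nc; rewrite un // ?U1E //.
  have [E|_] := eqVneq c (2, j); first by move: nc; rewrite E /= leqnn.
  have [E|//] := eqVneq c (2, j.+1).
  by move: nc; rewrite E /= leqnSn.
by apply: contra nc => /andP[-> /ltnW].
Qed.

Lemma rowseg_eq (U V : filling) i j n :
  (forall x, j <= x < j + n -> U (i, x) = V (i, x)) -> rowseg U i j n = rowseg V i j n.
Proof. by move=> E; apply/eq_in_map => x; rewrite mem_iota => /E. Qed.

Lemma slide_down R1 R2 f (U : filling) k v j :
  {in cells la &, injective U} -> 0 < j -> j + size R1 <= l1 -> j + size R2 = l2 ->
  size R2 <= f -> U (1, j) = k -> U (2, j) = v ->
  rowseg U 1 j.+1 (size R1) = R1 -> rowseg U 2 j.+1 (size R2) = R2 ->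
  let: (U', e) := slide la k f (exchange U k v) in
  [/\ {in cells la &, injective U'}, rowins k R2 = (rowseg U' 2 j (size R2).+1, e),
      rowseg U' 1 j (size R1).+1 = v :: R1
    & {in cells la, forall c, c.2 < j -> U' c = U c}].
Proof.
move=> injU j0 jR1 jR2 lef Uk Uv UR1 UR2.
have cl : (1, j) \in cells la by rewrite mem_row1; lia.
have dl : (2, j) \in cells la by rewrite mem_row2; lia.
set U1 := exchange U k v.
have U1E : {in cells la, U1 =1 fun x =>
    if x == (1, j) then v else if x == (2, j) then k else U x}.
  by rewrite /U1 -Uk -Uv; exact: exchange_cells.
have E2 : rowseg U1 2 j (size R2).+1 = k :: R2.
  rewrite /rowseg /= U1E // xpair_eqE /= eqxx; congr cons.
  rewrite -[RHS]UR2; apply: rowseg_eq => x xr.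
  have xl : (2, x) \in cells la by rewrite mem_row2; lia.
  by rewrite U1E // !xpair_eqE /=; case: eqP => //; lia.
have iU1 : {in cells la &, injective U1} by exact: exchange_inj.
have := slide_row2 iU1 j0 jR2 lef E2.
case: (slide la k f U1) => U' e [injU' -> un]; split=> //.
  rewrite /rowseg /= un // U1E // eqxx; congr cons.
  rewrite -[RHS]UR1; apply: rowseg_eq => x xr.
  have xl : (1, x) \in cells la by rewrite mem_row1; lia.
  by rewrite un // U1E // !xpair_eqE /=; case: eqP => //; lia.
move=> c cin cj; rewrite un ?negb_and -?ltnNge ?cj ?orbT // U1E //.
by case: eqP cj => [->|_]; rewrite ?ltnn //; case: eqP => [->|//]; rewrite ltnn.
Qed.

Lemma exchange_right R1 (U : filling) k u j :
  {in cells la &, injective U} -> 0 < j -> j + (size R1).+1 = l1 ->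
  U (1, j) = k -> U (1, j.+1) = u -> rowseg U 1 j.+2 (size R1) = R1 ->
  let U1 := exchange U k u in
  [/\ rowseg U1 1 j.+1 (size R1).+1 = k :: R1, U1 (1, j) = u &
      {in cells la, forall c, (c.2 < j) || (c.1 == 2) -> U1 c = U c}].
Proof.
move=> injU j0 jR1 Uk Uu UR1 U1.
have cl : (1, j) \in cells la by rewrite mem_row1; lia.
have dl : (1, j.+1) \in cells la by rewrite mem_row1; lia.
have U1E : {in cells la, U1 =1 fun x =>
    if x == (1, j) then u else if x == (1, j.+1) then k else U x}.
  by rewrite /U1 -Uk -Uu; exact: exchange_cells.
split; last first.
- move=> c cin cj; rewrite U1E //.
  have [E|_] := eqVneq c (1, j); first by move: cj; rewrite E /= ltnn.
  have [E|//] := eqVneq c (1, j.+1); by move: cj; rewrite E /= ltnNge leqnSn.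
- by rewrite U1E ?eqxx.
rewrite /rowseg /= U1E // !xpair_eqE /= eqxx (gtn_eqF (ltnSn j)); congr cons.
rewrite -[RHS]UR1; apply: rowseg_eq => x xr.
have xl : (1, x) \in cells la by rewrite mem_row1; lia.
by rewrite U1E // !xpair_eqE /=; case: eqP => [|_]; [lia|]; case: eqP => //; lia.
Qed.

(** Induction along the moves to the right; after a drop [slide_down] takes over. At most [size R1]
    moves to the right and one drop occur, whence the bound on [f]. The truncated [l2.+1 - j] makes
    [R2] empty beyond column [l2]. *)
Lemma slide_row1 R1 R2 f (U : filling) k j :
  {in cells la &, injective U} -> 0 < j -> j + size R1 = l1 -> size R2 = l2.+1 - j ->
  size R1 < f ->
  rowseg U 1 j (size R1).+1 = k :: R1 -> rowseg U 2 j (size R2) = R2 ->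
  let: (U', e) := slide la k f U in
  [/\ {in cells la &, injective U'},
      colins k R1 R2 = (rowseg U' 1 j (size R1).+1, rowseg U' 2 j (size R2), e)
    & {in cells la, forall c, c.2 < j -> U' c = U c}].
Proof.
elim: R1 R2 f U j => [|u R1 IHR] R2 [//|f] U j injU j0 jR sR2 lef; rewrite /= in jR lef.
  case=> Uk UR2; have cl : (1, j) \in cells la by rewrite mem_row1 j0; lia.
  have nr : (right_of (1, j) \in cells la) = false by rewrite mem_row1 /=; lia.
  rewrite -{1}Uk slideS // /corner nr /min_neighbour /= nr andbT /below /=.
  case: R2 sR2 UR2 => [|v R2] /= sR2 UR2.
    have -> : ((2, j) \in cells la) = false by rewrite mem_row2; lia.
    by rewrite /= /rowseg /= Uk; split.
  have el : (2, j) \in cells la by rewrite mem_row2; lia.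
  have [Uv UR] : U (2, j) = v /\ rowseg U 2 j.+1 (size R2) = R2 by case: UR2.
  rewrite el /= minnn Uk Uv.
  have [lt|ge] := ltnP k v.
    by rewrite ltnNge ltnW //= UR2 /rowseg /= Uk; split.
  have {ge} lt : v < k.
    rewrite ltn_neqAle ge andbT; apply/eqP => vk.
    by have := injU _ _ el cl; rewrite Uk Uv => /(_ vk).
  rewrite lt; have := @slide_down [::] R2 f U k v j injU j0.
  rewrite Uk Uv !addn0 => /(_ _ _ _ erefl erefl erefl UR) D.
  have {D} := D ltac:(lia) ltac:(lia) ltac:(lia).
  by case: (slide la k f _) => U' e [? -> /= -> ?]; split.
case=> Uk Uu UR1 UR2.
have cl : (1, j) \in cells la by rewrite mem_row1 j0; lia.
have dl : (1, j.+1) \in cells la by rewrite mem_row1 /=; lia.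
rewrite -{1}Uk slideS // /corner /min_neighbour /= dl /= andbF /right_of /below /=.
have nku : u != k.
  apply/eqP => uk; have := injU _ _ dl cl; rewrite Uk Uu => /(_ uk) [] /eqP.
  by rewrite (gtn_eqF (ltnSn j)).
have [X1 X2 X3] := exchange_right injU j0 jR Uk Uu UR1.
have leq2 : j.+1 + size R1 = l1 by lia.
case: R2 sR2 UR2 => [|v R2] /= sR2 UR2.
  have -> : ((2, j) \in cells la) = false by rewrite mem_row2; lia.
  rewrite /= minnn Uk Uu.
  have [lt|ge] := ltnP k u.
    by rewrite ltnNge ltnW //= /rowseg /= Uk Uu UR1; split.
  rewrite ltn_neqAle nku ge /=.
  have := IHR [::] f _ j.+1 (exchange_inj injU) isT leq2 _ lef X1 erefl.
  case: (slide la k f _) => U' e /(_ ltac:(move=> /=; lia)) [injU' -> un]; split=> //.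
    by rewrite /rowseg /= (un (1, j)) ?X2 /=.
  by move=> c cin cj; rewrite un ?X3 ?cj // ltnW.
have el : (2, j) \in cells la by rewrite mem_row2; lia.
rewrite el /=.
have [Uv UR] : U (2, j) = v /\ rowseg U 2 j.+1 (size R2) = R2 by case: UR2.
(* The fold in [min_neighbour] starts from the head of its list, so the entry below occurs twice. *)
rewrite Uk Uu Uv (minnC u v) minnA minnn.
have nkv : v != k.
  by apply/eqP => vk; have := injU _ _ el cl; rewrite Uk Uv => /(_ vk).
have nuv : v != u.
  by apply/eqP => vu; have := injU _ _ el dl; rewrite Uu Uv => /(_ vu).
have [lt|ge] := ltnP k (minn v u).
  by rewrite ltnNge ltnW //= UR2 /rowseg /= Uk Uu UR1; split.
have [ltuv|levu] := ltnP u v.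
  have Em : minn v u = u by apply/minn_idPr/ltnW.
  rewrite Em in ge *; rewrite ltn_neqAle nku ge /=.
  have E2 : rowseg (exchange U k u) 2 j.+1 (size R2) = R2.
    rewrite -[RHS]UR; apply: rowseg_eq => x xr; apply: X3; rewrite ?orbT //.
    by rewrite mem_row2; lia.
  have := IHR R2 f _ j.+1 (exchange_inj injU) isT leq2 _ lef X1 E2.
  case: (slide la k f _) => U' e /(_ ltac:(lia)) [injU' -> un]; split=> //.
    by rewrite /rowseg /= (un (1, j)) ?X2 ?(un (2, j)) ?X3 ?orbT /= ?Uv.
  by move=> c cin cj; rewrite un ?X3 ?cj // ltnW.
have Em : minn v u = v by apply/minn_idPl.
rewrite Em in ge *; rewrite ltn_neqAle nkv ge /=.
have := @slide_down (u :: R1) R2 f U k v j injU j0.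
rewrite Uk Uv => /(_ _ _ _ erefl erefl _ UR) D.
have {D} := D ltac:(move=> /=; lia) ltac:(lia) ltac:(lia).
case: (slide la k f _) => U' e.
rewrite [rowseg U 1 _ _]/rowseg /= Uu UR1 => /(_ erefl) [? -> -> ?].
by split.
Qed.
End TwoRows.

(** * The order of the cells and the whole run *)

Definition col_cells l2 j : seq (nat * nat) :=
  if j <= l2 then [:: (2, j); (1, j)] else [:: (1, j)].

Fixpoint cell_order l2 n : seq (nat * nat) :=
  if n is n'.+1 then col_cells l2 n ++ cell_order l2 n' else [::].

Lemma mem_cell_order l2 n c : (c \in cell_order l2 n) =
  (0 < c.2 <= n) && ((c.1 == 1) || (c.1 == 2) && (c.2 <= l2)).
Proof.
case: c => i j /=; elim: n => [|n IHn] /=; first by case: j.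
rewrite mem_cat IHn /col_cells; case: ifP => le; rewrite !inE !xpair_eqE.
  by apply/idP/idP; lia.
by apply/idP/idP; lia.
Qed.

Lemma pairwise_cell_order l2 n : pairwise (fun c d => col_le d c) (cell_order l2 n).
Proof.
elim: n => //= n IHn; rewrite pairwise_cat IHn andbT; apply/andP; split.
  apply/allrelP => -[i j] [a b] cc; rewrite mem_cell_order => /andP[/andP[_ /= dn] _].
  move: cc; rewrite /col_le /col_cells.
  by case: ifP => _; rewrite !inE !xpair_eqE /=; lia.
by rewrite /col_cells; case: ifP => _ //=; rewrite /col_le /= eqxx /= ltnn.
Qed.

Lemma uniq_cell_order l2 n : uniq (cell_order l2 n).
Proof.
elim: n => //= n IHn; rewrite cat_uniq IHn andbT; apply/andP; split.
  by rewrite /col_cells; case: ifP.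
apply/hasPn => -[i j]; rewrite mem_cell_order => /andP[/andP[_ /= dn] _].
by rewrite /col_cells; case: ifP => _; rewrite !inE !xpair_eqE /=; lia.
Qed.

Lemma uniq_cells la : uniq (cells la).
Proof.
apply: allpairs_uniq_dep => [|x _|]; rewrite ?iota_uniq //.
by move=> [x a] [y b] _ _ /= [-> ->].
Qed.

Lemma perm_cell_order l1 l2 : l2 <= l1 -> perm_eq (cells [:: l1; l2]) (cell_order l2 l1).
Proof.
move=> le; apply: uniq_perm; rewrite ?uniq_cells ?uniq_cell_order // => c.
rewrite mem_cells mem_cell_order; case: c => [[|[|[|i]]] j] //=; rewrite ?nth_nil; lia.
Qed.

Lemma sort_cells l1 l2 : l2 <= l1 ->
  sort (fun c d => col_le d c) (cells [:: l1; l2]) = cell_order l2 l1.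
Proof.
move=> le; have tr : transitive (fun c d => col_le d c).
  by move=> [a b] [c d] [e f]; rewrite /col_le /=; lia.
apply: (sorted_eq tr).
- by move=> [a b] [c d]; rewrite /col_le /= => H; congr pair; lia.
- by apply: sort_sorted => [[a b] [c d]]; rewrite /col_le /=; lia.
- exact/pairwise_sorted/pairwise_cell_order.
- by rewrite perm_sort perm_cell_order.
Qed.

Lemma flags_cell_order l d :
  [seq c.1 == 1 | c <- cell_order l (l + d)] = row_flags d l.
Proof.
rewrite /row_flags; elim: d => [|d IHd]; last first.
  by rewrite addnS /= map_cat IHd /col_cells ltnNge leq_addr.
suff E n : n <= l ->
    [seq c.1 == 1 | c <- cell_order l n] = flatten (nseq n [:: false; true]).
  by rewrite addn0 E.
elim: n => //= n IHn le.
by rewrite map_cat /col_cells le IHn // ltnW.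
Qed.

(** The columns up to [n] remain to be treated and still hold their initial entries, while [R1] and
    [R2] are the current rows to the right of column [n]. *)
Lemma nps_fold l1 l2 n (T U : filling) e R1 R2 : l2 <= l1 -> n <= l1 ->
  let la := [:: l1; l2] in
  {in cells la &, injective U} -> {in cells la, forall c, c.2 <= n -> U c = T c} ->
  n + size R1 = l1 -> size R2 = l2 - n ->
  rowseg U 1 n.+1 (size R1) = R1 -> rowseg U 2 n.+1 (size R2) = R2 ->
  (foldl (nps_step la T) (U, e) (cell_order l2 n)).2 =
  (foldl abstep (R1, R2, e) [seq (c.1 == 1, T c) | c <- cell_order l2 n]).2.
Proof.
move=> le21 + la.
elim: n U e R1 R2 => [|n IHn] U e R1 R2 // nl injU UT s1 s2 U1 U2.
have c1 : (1, n.+1) \in cells la by rewrite mem_row1; lia.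
(* The treatment of a row-1 cell, common to columns with one and with two cells; [Q2] already
   includes the row-2 cell of the column, if any. *)
have colstep (V : filling) e' Q2 : {in cells la &, injective V} ->
    {in cells la, forall c, c.2 <= n -> V c = T c} -> V (1, n.+1) = T (1, n.+1) ->
    size Q2 = l2 - n -> rowseg V 1 n.+2 (size R1) = R1 -> rowseg V 2 n.+1 (size Q2) = Q2 ->
    (foldl (nps_step la T) (V, e') ((1, n.+1) :: cell_order l2 n)).2 =
    (foldl abstep (R1, Q2, e')
       [seq (c.1 == 1, T c) | c <- (1, n.+1) :: cell_order l2 n]).2.
  move=> injV VT V1 sQ R1V Q2V.
  have sQ' : size Q2 = l2.+1 - n.+1 by rewrite subSS.
  have fuel : size R1 < slide_fuel la by rewrite /slide_fuel /=; lia.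
  have R1V' : rowseg V 1 n.+1 (size R1).+1 = T (1, n.+1) :: R1.
    by rewrite -V1 -[in RHS]R1V.
  have := slide_row1 le21 injV (ltn0Sn n) s1 sQ' fuel R1V' Q2V.
  case E: slide => [V' a] [injV' C un].
  transitivity (foldl (nps_step la T) (nps_step la T (V, e') (1, n.+1)) (cell_order l2 n)).2.
    by [].
  have -> : nps_step la T (V, e') (1, n.+1) = (V', e' + a).
    by rewrite /nps_step [slide _ _ _ _]E.
  transitivity (foldl abstep (abstep (R1, Q2, e') (true, T (1, n.+1)))
    [seq (c.1 == 1, T c) | c <- cell_order l2 n]).2; last by [].
  rewrite [abstep _ _]/= C.
  apply: IHn => //; first lia.
  - by move=> c cin cn; rewrite un // VT.
  - by rewrite size_map size_iota; lia.
  - by rewrite size_map size_iota sQ.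
  - by rewrite size_map size_iota.
  - by rewrite size_map size_iota.
rewrite [cell_order _ _]/= /col_cells; case: ifP => le; last first.
  rewrite cat1s; apply: colstep => //.
  - by move=> c cin cn; rewrite UT // ltnW.
  - by rewrite UT.
  - by rewrite s2; lia.
  - by have -> : R2 = [::] by apply: size0nil; lia.
have c2 : (2, n.+1) \in cells la by rewrite mem_row2 le.
have s2' : n.+1 + size R2 = l2 by lia.
have fuel : size R2 <= slide_fuel la by rewrite /slide_fuel /=; lia.
have U2' : rowseg U 2 n.+1 (size R2).+1 = T (2, n.+1) :: R2.
  by rewrite -[in RHS]U2 -UT.
have := slide_row2 le21 injU (ltn0Sn n) s2' fuel U2'.
case E: slide => [V a] [injV C un].
transitivity (foldl (nps_step la T) (nps_step la T (U, e) (2, n.+1))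
  ((1, n.+1) :: cell_order l2 n)).2; first by [].
have -> : nps_step la T (U, e) (2, n.+1) = (V, e + a).
  by rewrite /nps_step [slide _ _ _ _]E.
transitivity (foldl abstep (abstep (R1, R2, e) (false, T (2, n.+1)))
    [seq (c.1 == 1, T c) | c <- (1, n.+1) :: cell_order l2 n]).2; last by [].
rewrite [abstep _ _]/= C.
apply: (colstep V) => //.
- by move=> c cin cn; rewrite un ?UT //; [exact: ltnW | rewrite negb_and -ltnNge ltnS cn orbT].
- by rewrite un ?UT.
- by rewrite size_map size_iota; lia.
- rewrite -[RHS]U1; apply: rowseg_eq => x xr; apply: un => //.
  by rewrite mem_row1; lia.
- by rewrite size_map size_iota.
Qed.

Lemma nps_exchanges_abrun l d (T : filling) :
  let la := [:: (l + d); l] in {in cells la &, injective T} ->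
  nps_exchanges la T = (abrun (row_flags d l) [seq T c | c <- cell_order l (l + d)]).2.
Proof.
move=> la injT; rewrite /nps_exchanges /nps sort_cells ?leq_addr //.
rewrite (@nps_fold (l + d) l (l + d) T T 0 [::] [::]) ?leq_addr ?addn0 //=; last by lia.
by rewrite /abrun -flags_cell_order zip_map.
Qed.

(** * Tableaux as permutations *)

Lemma entry_val la (T : {ffun cell la -> 'I_(sumn la)}) (x : cell la) :
  entry T (val x) = (T x).+1.
Proof. by rewrite /entry valK. Qed.

Lemma entry_inj la (T : {ffun cell la -> 'I_(sumn la)}) : injective T ->
  {in cells la &, injective (entry T)}.
Proof.
move=> injT c d cl dl; have -> : c = val (Sub c cl : cell la) by rewrite SubK.
have -> : d = val (Sub d dl : cell la) by rewrite SubK.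
by rewrite !entry_val => -[/val_inj/injT ->].
Qed.

Lemma card_cell l1 l2 : l2 <= l1 -> #|cell [:: l1; l2]| = sumn [:: l1; l2].
Proof.
move=> le; rewrite card_seq_sub ?uniq_cells // size_allpairs_dep /=.
by rewrite !size_iota.
Qed.

Lemma tableauxE l1 l2 : l2 <= l1 -> let la := [:: l1; l2] in
  tableaux la = [set T : {ffun cell la -> 'I_(sumn la)} | injectiveb T].
Proof.
move=> le la; apply/setP => T; rewrite !inE; case: injectiveP => //= injT.
apply/forallP => k; apply/existsP.
have /codomP[c ->] : k \in codom T; last by exists c.
by apply: inj_card_onto => //; rewrite card_ord card_cell.
Qed.

(** Reading a tableau in the order of treatment is injective and yields permutations; since there
    are [n!] objects on both sides, no inverse has to be built. *)
Lemma perm_words l1 l2 : l2 <= l1 ->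
  perm_eq
    [seq [seq entry T c | c <- cell_order l2 l1] | T <- enum (tableaux [:: l1; l2])]
    (permutations (iota 1 (sumn [:: l1; l2]))).
Proof.
set la := [:: l1; l2] => le; have po := perm_cell_order le.
have injT T : T \in enum (tableaux la) -> injective T.
  by rewrite mem_enum tableauxE // inE => /injectiveP.
set X := map _ _.
have uX : uniq X.
  rewrite map_inj_in_uniq ?enum_uniq // => T T' _ _ /eq_in_map E.
  apply/ffunP => x; apply: val_inj; apply: succn_inj; rewrite -!entry_val; apply: E.
  by rewrite -(perm_mem po) (valP x).
have sX : {subset X <= permutations (iota 1 (sumn la))}.
  move=> w /mapP[T /injT iT ->]; rewrite mem_permutations.
  have uw : uniq [seq entry T c | c <- cell_order l2 l1].
    rewrite map_inj_in_uniq ?uniq_cell_order // => c d.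
    by rewrite -!(perm_mem po); exact: entry_inj.
  apply: uniq_perm; rewrite ?iota_uniq //.
  have sub : {subset [seq entry T c | c <- cell_order l2 l1] <= iota 1 (sumn la)}.
    move=> m /mapP[c]; rewrite -(perm_mem po) => cl ->.
    have -> : c = val (Sub c cl : cell la) by rewrite SubK.
    by rewrite entry_val mem_iota; apply/andP; split=> //; rewrite add1n ltnS; exact: ltn_ord.
  have [] // := uniq_min_size uw sub.
  by rewrite size_iota size_map -(perm_size po) -card_cell // card_seq_sub ?uniq_cells.
apply: uniq_perm; rewrite ?permutations_uniq //.
have [] // := uniq_min_size uX sX.
rewrite size_permutations ?iota_uniq // size_iota size_map -cardE tableauxE //.
by rewrite card_inj_ffuns card_ord card_cell // ffactnn.
Qed.

Local Open Scope ring_scope.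

Lemma sum_nps_exchanges l d :
  \sum_(T in tableaux [:: (l + d)%N; l]) (nps_exchanges [:: (l + d)%N; l] (entry T))%:R
  = \sum_(c <- codes (2 * l + d)) (brun (row_flags d l) c).2%:R :> rat.
Proof.
set la := [:: _; _]; have le : (l <= l + d)%N := leq_addr d l.
pose rs := row_flags d l.
have sn : sumn la = (2 * l + d)%N by rewrite /la /=; lia.
transitivity (\sum_(w <- permutations (iota 1 (sumn la))) (brun rs (code w)).2%:R : rat).
  transitivity (\sum_(w <- permutations (iota 1 (sumn la))) (abrun rs w).2%:R : rat).
    rewrite -(perm_big _ (perm_words le)) big_map big_enum /=.
    apply: eq_bigr => T; rewrite tableauxE // inE => /injectiveP injT.
    by rewrite nps_exchanges_abrun //; exact: entry_inj.
  rewrite big_seq [RHS]big_seq; apply: eq_bigr => w; rewrite mem_permutations => pw.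
  have uw : uniq w by rewrite (perm_uniq pw) iota_uniq.
  have sw : size rs = size w by rewrite (perm_size pw) size_iota sn size_row_flags.
  have := abrun_code uw sw; case: (brun rs (code w)) => s e [A [_ _ _ ->]].
  by [].
rewrite (sum_permutations_code (fun c => (brun rs c).2%:R)) ?size_iota ?sn //.
exact: iota_ltn_sorted.
Qed.

Theorem mainTheorem8 (l1 l2 d : nat) (hl2 : (0 < l2)%N) (hl1 : l1 = (l2 + d)%N) :
  nps_complexity [:: l1; l2] =
    l1%:R * (l1%:R - 1) / 4 + l2%:R * (l2%:R - 3) / 4
    - 2 * (
      (- 1 - d%:R + (d%:R + 1) * 2 ^+ (2 * l2) / 'C(2 * l2, l2)%:R)
        * (\sum_(1 <= i < d.+1)
             2 ^+ i * 'C(i + l2, i)%:R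
             / ('C(i + 2 * l2, i)%:R * (1 + i%:R + 2 * l2%:R)))
      + 2 ^+ (d + 2) * l2%:R * (1 + d%:R + l2%:R) * 'C(d + l2, d)%:R
          / ('C(d + 2 * l2, d)%:R * (1 + d%:R + 2 * l2%:R))
        * (\sum_(1 <= i < d.+1)
             2 ^- i * 'C(i + 2 * l2, i)%:R
             / ('C(i + l2, i)%:R * (i%:R + 2 * l2%:R)))
      - 2 * (d%:R + 1) * l2%:R
        * (\sum_(1 <= i < d.+1)
             2 ^+ i * 'C(i + l2, i)%:R
             / ('C(i + 2 * l2, i)%:R * (1 + i%:R + 2 * l2%:R))
             * (\sum_(1 <= j < i.+1)
                  2 ^- j * 'C(j + 2 * l2, j)%:R
                  / ('C(j + l2, j)%:R * (j%:R + 2 * l2%:R))))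
      + 2 ^+ (2 * l2) * (d%:R + 1) / ('C(2 * l2, l2)%:R * (2 * l2%:R + 1))
      + 2 ^+ (d + 1) * (1 + d%:R + l2%:R) * 'C(d + l2, d)%:R
          / ('C(d + 2 * l2, d)%:R * 'C(2 * l2, l2)%:R * (1 + d%:R + 2 * l2%:R))
        * (- 2 ^+ (2 * l2) + 'C(2 * l2, l2)%:R)
      - (d%:R + 1) / (2 * l2%:R + 1)
      + (d%:R + 1) * harmonic (d + 2 * l2)
      + 1 / 2 * (d%:R + 1) * harmonic l2
      - (d%:R + 1) * harmonic (2 * l2)
      - (d%:R + 1) * harmonic d).
Proof.
(* Both sides now contain the same sum of [column_term] over [d + 1]; only the polynomial parts in
   [l2] and [d] remain to be compared. *)
rewrite closed_form // bracketE {}hl1 /nps_complexity sum_nps_exchanges sum_brun_cost.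
have -> : sumn [:: (l2 + d)%N; l2] = (2 * l2 + d)%N by rewrite /=; lia.
have f0 := factr_neq0 (2 * l2 + d).
have d0 := ler0n rat d.
rewrite natrD; move: (_`!%:R) f0 (\sum_(0 <= b < l2) _) => f f0 K.
by field; rewrite f0 /=; neqs.
Qed.
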